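(* Let $\Gamma$ be a global context all of whose rewrite rules satisfy the encoding conditions. If the HRS $\mathrm{HRS}(\beta\Gamma)$ is confluent, then product compatibility $\mathbf{PC}(\Gamma)$ holds.
   Context: The $\lambda\Pi$-calculus modulo. Objects $t ::= x \mid c \mid t\,t \mid \lambda x:U.t$; types $U,V ::= C \mid U\,t \mid \lambda x:U.V \mid \Pi x:U.V$; kinds $K ::= \mathrm{Type}\mid\Pi x:U.K$; a term is an object, type, kind or $\mathrm{Kind}$; sorts $s\in\{\mathrm{Type},\mathrm{Kind}\}$. Local context: list of $(x:U)$; global context: list of $(c:U)$, $(C:K)$ and rewrite rules $(u\to v)$ (pairs of objects or of types). $\to_\beta$: least relation containing $(\lambda x:A.u)v\to u[x/v]$, closed under subterms; $\to_\Gamma$: least relation containing the rules of $\Gamma$, closed under arbitrary substitution and subterms; $\equiv_{\beta\Gamma}$: congruence generated by $\to_\beta\cup\to_\Gamma$. Typing: (Sort) $\Gamma;\Delta\vdash\mathrm{Type}:\mathrm{Kind}$; (Variable) $(x:A)\in\Delta\Rightarrow\Gamma;\Delta\vdash x:A$; (Constant) $(c:A)\in\Gamma\Rightarrow\Gamma;\Delta\vdash c:A$; (Application) $\Gamma;\Delta\vdash t:\Pi x:A.B$, $\Gamma;\Delta\vdash u:A\Rightarrow\Gamma;\Delta\vdash tu:B[x/u]$; (Abstraction) $\Gamma;\Delta\vdash A:\mathrm{Type}$, $\Gamma;\Delta(x:A)\vdash t:B$, $B\ne\mathrm{Kind}\Rightarrow\Gamma;\Delta\vdash\lambda x:A.t:\Pi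 x:A.B$; (Product) $\Gamma;\Delta\vdash A:\mathrm{Type}$, $\Gamma;\Delta(x:A)\vdash B:s\Rightarrow\Gamma;\Delta\vdash\Pi x:A.B:s$; (Conversion) $\Gamma;\Delta\vdash t:A$, $\Gamma;\Delta\vdash B:s$, $A\equiv_{\beta\Gamma}B\Rightarrow\Gamma;\Delta\vdash t:B$. Well-formed local contexts: $\vdash_\Gamma\emptyset$; $\vdash_\Gamma\Delta$, $\Gamma;\Delta\vdash U:\mathrm{Type}$, $x\notin dom(\Delta)\Rightarrow\vdash_\Gamma\Delta(x:U)$. $\mathbf{PC}(\Gamma)$: whenever $\Pi x:A_1.B_1$ and $\Pi x:A_2.B_2$ are well-typed in the same well-formed local context and $\Pi x:A_1.B_1\equiv_{\beta\Gamma}\Pi x:A_2.B_2$, then $A_1\equiv_{\beta\Gamma}A_2$ and $B_1\equiv_{\beta\Gamma}B_2$. HRS: simple types over base type $\mathtt{term}$; $\mathtt{term}^1=\mathtt{term}$, $\mathtt{term}^{n+1}=\mathtt{term}\to\mathtt{term}^n$. Signature: $\mathtt{Type},\mathtt{Kind}:\mathtt{term}$, $\mathtt{app}:\mathtt{term}\to\mathtt{term}\to\mathtt{term}$, $\mathtt{lam},\mathtt{pi}:\mathtt{term}\to(\mathtt{term}\to\mathtt{term})\to\mathtt{term}$, $\mathtt{c}:\mathtt{term}$ per constant $c$. HRS-terms: simply typed $\lambda$-terms ($t(u)$, $\underline\lambda x.t$) in long $\beta\eta$-normal form; $\Downarrow t$ long $\beta\eta$-normal form. Pattern: every free occurrence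 of a variable $F$ is in a subterm $F(u_1,\dots,u_n)$ with the $u_i$ $\eta$-equivalent to distinct bound variables. HRS rule $(l\to r)$: same base type, $l$ a pattern not $\eta$-equivalent to a variable, $FV(r)\subseteq FV(l)$. For a set $R$ of rules, $\to_R$ is the least relation on HRS-terms closed under subterms with $\Downarrow\sigma(l)\to_R\Downarrow\sigma(r)$ for each rule and well-typed substitution $\sigma$; $R$ is confluent if $\to_R$ is. Encoding: for $t$ uniform in $V$ (all occurrences of each free variable of $t$ not in $V$ applied to the same number of arguments), $[\![\mathrm{Kind}]\!]_V=\mathtt{Kind}$, $[\![\mathrm{Type}]\!]_V=\mathtt{Type}$, $[\![c]\!]_V=\mathtt{c}$, $[\![x]\!]_V=x:\mathtt{term}$ if $x\in V$, $[\![\lambda x:A.u]\!]_V=\mathtt{lam}([\![A]\!]_V,\underline\lambda x.[\![u]\!]_{V\cup\{x\}})$, $[\![\Pi x:A.B]\!]_V=\mathtt{pi}([\![A]\!]_V,\underline\lambda x.[\![B]\!]_{V\cup\{x\}})$, $[\![x\,v_1\dots v_n]\!]_V=x([\![v_1]\!]_V,\dots,[\![v_n]\!]_V)$ for $x\notin V$ ($x:\mathtt{term}^{n+1}$), $[\![uv]\!]_V=\mathtt{app}([\![u]\!]_V,[\![v]\!]_V)$ otherwise. $\lambda\Pi$-patterns: for $V=(V_0,\mathcal A)$ ($\mathcal A$ arity function), $\mathcal P_V$ is least with: constants; $pq$ for $p,q\in\mathcal P_V$; $x\in V_0$; $p\,(x\vec y)$ for $p\in\mathcal P_V$, $x\notin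 V_0$, $\vec y$ pairwise distinct in $V_0$ with $|\vec y|=\mathcal A(x)$; $p\,(\lambda x:A.q)$ for $p\in\mathcal P_V$, $FV(A)\subseteq V_0$, $q\in\mathcal P_{(V_0\cup\{x\},\mathcal A)}$. A $\lambda\Pi$-pattern is an element of some $\mathcal P_{(\emptyset,\mathcal A)}$. Encoding conditions on a rule $(u\to v)$: $u$ a $\lambda\Pi$-pattern, $FV(v)\subseteq FV(u)$, every free variable applied to the same number of arguments at all its occurrences in $u$ and $v$; $[\![u\to v]\!]=([\![u]\!]_\emptyset\to[\![v]\!]_\emptyset)$. $\mathrm{HRS}(\beta\Gamma)=\{[\![u\to v]\!]:(u\to v)\in\Gamma\}\cup\{\mathtt{app}(\mathtt{lam}(X,\underline\lambda x.Y(x)),Z)\to Y(Z)\}$ (with $X,Z:\mathtt{term}$, $Y:\mathtt{term}\to\mathtt{term}$). *)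

(* Defs.v *)
From Stdlib Require Import List Relations.
Import ListNotations.

(** Binders are represented by de Bruijn indices, so that terms are taken up to
    alpha-conversion.  Sets [V] of variables are boolean predicates on indices
    and typing environments are functions on indices; [scons] extends all of
    them (and substitutions) under a binder. *)

Definition scons {X : Type} (a : X) (f : nat -> X) (i : nat) : X :=
  match i with O => a | S j => f j end.

Definition vset := nat -> bool.
Definition vempty : vset := fun _ => false.

(** Object constants [c] and type constants [C] have separate, countably
    infinite name spaces. *)
Inductive term : Type :=
| TKind : term
| TType : term
| Var (i : nat) : term
| Cst (c : nat) : term
| TCst (C : nat) : term
| App (t u : term) : term
| Lam (A t : term) : term
| Pi (A B : term) : term.

Inductive is_object : term -> Prop :=
| object_var i : is_object (Var i)
| object_cst c : is_object (Cst c)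
| object_app t u : is_object t -> is_object u -> is_object (App t u)
| object_lam U t : is_type U -> is_object t -> is_object (Lam U t)
with is_type : term -> Prop :=
| type_cst C : is_type (TCst C)
| type_app U t : is_type U -> is_object t -> is_type (App U t)
| type_lam U V : is_type U -> is_type V -> is_type (Lam U V)
| type_pi U V : is_type U -> is_type V -> is_type (Pi U V).

Inductive is_kind : term -> Prop :=
| kind_type : is_kind TType
| kind_pi U K : is_type U -> is_kind K -> is_kind (Pi U K).

Definition is_term (t : term) : Prop :=
  is_object t \/ is_type t \/ is_kind t \/ t = TKind.

Inductive is_sort : term -> Prop :=
| sort_type : is_sort TType
| sort_kind : is_sort TKind.

Definition up_ren (r : nat -> nat) : nat -> nat :=
  scons 0 (fun i => S (r i)).

Fixpoint rename (r : nat -> nat) (t : term) : term :=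
  match t with
  | Var i => Var (r i)
  | App t u => App (rename r t) (rename r u)
  | Lam A t => Lam (rename r A) (rename (up_ren r) t)
  | Pi A B => Pi (rename r A) (rename (up_ren r) B)
  | _ => t
  end.

Definition up (s : nat -> term) : nat -> term :=
  scons (Var 0) (fun i => rename S (s i)).

Fixpoint subst (s : nat -> term) (t : term) : term :=
  match t with
  | Var i => s i
  | App t u => App (subst s t) (subst s u)
  | Lam A t => Lam (subst s A) (subst (up s) t)
  | Pi A B => Pi (subst s A) (subst (up s) B)
  | _ => t
  end.

Definition subst1 (u t : term) : term := subst (scons u Var) t.

Fixpoint free (x : nat) (t : term) : Prop :=
  match t with
  | Var i => i = x
  | App t u => free x t \/ free x u
  | Lam A t => free x A \/ free (S x) t
  | Pi A B => free x A \/ free (S x) B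
  | _ => False
  end.

Fixpoint apps (t : term) (us : list term) : term :=
  match us with [] => t | u :: us => apps (App t u) us end.

Inductive decl : Type :=
| DCst (c : nat) (U : term)
| DTCst (C : nat) (K : term)
| DRule (u v : term).

Definition gctx := list decl.
(** The head of the list is the most recent variable, of index 0. *)
Definition lctx := list term.

Definition is_decl (d : decl) : Prop :=
  match d with
  | DCst _ U => is_type U
  | DTCst _ K => is_kind K
  | DRule u v => (is_object u /\ is_object v) \/ (is_type u /\ is_type v)
  end.

Definition is_gctx (G : gctx) : Prop := Forall is_decl G.

Inductive ctx_closure (R : relation term) : relation term :=
| ctx_root t t' : R t t' -> ctx_closure R t t'
| ctx_app_l t t' u : ctx_closure R t t' -> ctx_closure R (App t u) (App t' u)
| ctx_app_r t u u' : ctx_closure R u u' -> ctx_closure R (App t u) (App t u')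
| ctx_lam_l A A' t : ctx_closure R A A' -> ctx_closure R (Lam A t) (Lam A' t)
| ctx_lam_r A t t' : ctx_closure R t t' -> ctx_closure R (Lam A t) (Lam A t')
| ctx_pi_l A A' B : ctx_closure R A A' -> ctx_closure R (Pi A B) (Pi A' B)
| ctx_pi_r A B B' : ctx_closure R B B' -> ctx_closure R (Pi A B) (Pi A B').

Inductive beta_root : relation term :=
| beta_root_intro A u v : beta_root (App (Lam A u) v) (subst1 v u).

Inductive rule_root (G : gctx) : relation term :=
| rule_root_intro u v s :
    In (DRule u v) G -> (forall x, is_object (s x)) ->
    rule_root G (subst s u) (subst s v).

Definition beta : relation term := ctx_closure beta_root.
Definition gamma (G : gctx) : relation term := ctx_closure (rule_root G).

(** Only chains of terms of the stratified grammar count; without the [is_term]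
    conditions an expansion could leave the grammar, as in
    [c <- (fun x : A => c) Kind]. *)
Definition beta_gamma (G : gctx) : relation term :=
  fun t u => is_term t /\ is_term u /\ (beta t u \/ gamma G t u).

Definition conv (G : gctx) : relation term :=
  clos_refl_sym_trans term (beta_gamma G).

Inductive typing (G : gctx) : lctx -> term -> term -> Prop :=
| ty_sort D : typing G D TType TKind
| ty_var D i A :
    nth_error D i = Some A ->
    typing G D (Var i) (rename (fun k => S i + k) A)
| ty_cst D c A : In (DCst c A) G -> typing G D (Cst c) A
| ty_tcst D C A : In (DTCst C A) G -> typing G D (TCst C) A
| ty_app D t u A B :
    typing G D t (Pi A B) -> typing G D u A ->
    typing G D (App t u) (subst1 u B)
| ty_lam D A t B :
    typing G D A TType -> typing G (A :: D) t B -> B <> TKind ->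
    typing G D (Lam A t) (Pi A B)
| ty_pi D A B s :
    is_sort s ->
    typing G D A TType -> typing G (A :: D) B s ->
    typing G D (Pi A B) s
| ty_conv D t A B s :
    is_sort s ->
    typing G D t A -> typing G D B s -> conv G A B ->
    typing G D t B.

Inductive wf_lctx (G : gctx) : lctx -> Prop :=
| wf_nil : wf_lctx G []
| wf_cons D U : wf_lctx G D -> typing G D U TType -> wf_lctx G (U :: D).

Definition well_typed (G : gctx) (D : lctx) (t : term) : Prop :=
  exists T, typing G D t T.

Definition product_compatibility (G : gctx) : Prop :=
  forall D A1 B1 A2 B2,
    wf_lctx G D ->
    well_typed G D (Pi A1 B1) -> well_typed G D (Pi A2 B2) ->
    conv G (Pi A1 B1) (Pi A2 B2) ->
    conv G A1 A2 /\ conv G B1 B2.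

Inductive sty : Type :=
| base : sty
| arr (a b : sty) : sty.

(** [tpow n] is the type written term^(n+1): [n] arguments. *)
Fixpoint tpow (n : nat) : sty :=
  match n with O => base | S n => arr base (tpow n) end.

Inductive hconst : Type :=
| hType | hKind | happ | hlam | hpi
| hcst (c : nat) | htcst (C : nat).

Definition hconst_type (k : hconst) : sty :=
  match k with
  | hType | hKind | hcst _ | htcst _ => base
  | happ => arr base (arr base base)
  | hlam | hpi => arr base (arr (arr base base) base)
  end.

Inductive hterm : Type :=
| HVar (i : nat)
| HCst (k : hconst)
| HApp (t u : hterm)
| HLam (t : hterm).

Fixpoint hrename (r : nat -> nat) (t : hterm) : hterm :=
  match t with
  | HVar i => HVar (r i)
  | HCst k => HCst k
  | HApp t u => HApp (hrename r t) (hrename r u)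
  | HLam t => HLam (hrename (up_ren r) t)
  end.

Definition hup (s : nat -> hterm) : nat -> hterm :=
  scons (HVar 0) (fun i => hrename S (s i)).

Fixpoint hsubst (s : nat -> hterm) (t : hterm) : hterm :=
  match t with
  | HVar i => s i
  | HCst k => HCst k
  | HApp t u => HApp (hsubst s t) (hsubst s u)
  | HLam t => HLam (hsubst (hup s) t)
  end.

Definition hsubst1 (u t : hterm) : hterm := hsubst (scons u HVar) t.

Fixpoint hfree (x : nat) (t : hterm) : Prop :=
  match t with
  | HVar i => i = x
  | HCst _ => False
  | HApp t u => hfree x t \/ hfree x u
  | HLam t => hfree (S x) t
  end.

Fixpoint happs (t : hterm) (us : list hterm) : hterm :=
  match us with [] => t | u :: us => happs (HApp t u) us end.

(** Every variable has a type, as for Church-style typed variables. *)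
Definition tenv := nat -> sty.

Inductive htyping : tenv -> hterm -> sty -> Prop :=
| ht_var E i : htyping E (HVar i) (E i)
| ht_cst E k : htyping E (HCst k) (hconst_type k)
| ht_app E t u a b :
    htyping E t (arr a b) -> htyping E u a -> htyping E (HApp t u) b
| ht_lam E t a b :
    htyping (scons a E) t b -> htyping E (HLam t) (arr a b).

Inductive hctx_closure (R : relation hterm) : relation hterm :=
| hctx_root t t' : R t t' -> hctx_closure R t t'
| hctx_app_l t t' u :
    hctx_closure R t t' -> hctx_closure R (HApp t u) (HApp t' u)
| hctx_app_r t u u' :
    hctx_closure R u u' -> hctx_closure R (HApp t u) (HApp t u')
| hctx_lam t t' : hctx_closure R t t' -> hctx_closure R (HLam t) (HLam t').

Inductive hbeta_root : relation hterm :=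
| hbeta_root_intro t u : hbeta_root (HApp (HLam t) u) (hsubst1 u t).

Inductive heta_root : relation hterm :=
| heta_root_intro t : heta_root (HLam (HApp (hrename S t) (HVar 0))) t.

Definition eta_equiv : relation hterm :=
  clos_refl_sym_trans hterm (hctx_closure heta_root).

Definition beta_eta_equiv : relation hterm :=
  clos_refl_sym_trans hterm (hctx_closure (union hterm hbeta_root heta_root)).

(** [hrs_term E t a]: [t] has type [a] and is in long beta-eta-normal form,
    that is, of the form [fun x1 ... xn => h u1 ... um] where [h] is a variable
    or a constant, [h u1 ... um] has base type, and the [ui] are again in long
    normal form.  [neutral] describes the spines [h u1 ... uj]. *)
Inductive hrs_term : tenv -> hterm -> sty -> Prop :=
| hrs_lam E t a b : hrs_term (scons a E) t b -> hrs_term E (HLam t) (arr a b)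
| hrs_base E t : neutral E t base -> hrs_term E t base
with neutral : tenv -> hterm -> sty -> Prop :=
| neutral_var E i : neutral E (HVar i) (E i)
| neutral_cst E k : neutral E (HCst k) (hconst_type k)
| neutral_app E t u a b :
    neutral E t (arr a b) -> hrs_term E u a -> neutral E (HApp t u) b.

Definition long_nf (E : tenv) (a : sty) (t t' : hterm) : Prop :=
  htyping E t a /\ hrs_term E t' a /\ beta_eta_equiv t t'.

(** [hpattern E V t]: the variables of [V] are the bound ones.  Asking that the
    application of a free variable have base type says that all the arguments
    of that variable are among the distinct bound variables. *)
Inductive hpattern : tenv -> vset -> hterm -> Prop :=
| hpat_bound E V x : V x = true -> hpattern E V (HVar x)
| hpat_cst E V k : hpattern E V (HCst k)
| hpat_app E V t u : hpattern E V t -> hpattern E V u -> hpattern E V (HApp t u)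
| hpat_lam E V a t : hpattern (scons a E) (scons true V) t -> hpattern E V (HLam t)
| hpat_free E V x us ys :
    V x = false ->
    htyping E (happs (HVar x) us) base ->
    Forall2 (fun u y => eta_equiv u (HVar y)) us ys ->
    Forall (fun y => V y = true) ys -> NoDup ys ->
    hpattern E V (happs (HVar x) us).

(** A rule comes with the types of its free variables. *)
Record hrule : Type := HRule { hr_env : tenv; hr_lhs : hterm; hr_rhs : hterm }.

Definition is_hrule (r : hrule) : Prop :=
  hrs_term (hr_env r) (hr_lhs r) base /\
  hrs_term (hr_env r) (hr_rhs r) base /\
  hpattern (hr_env r) vempty (hr_lhs r) /\
  (forall x, ~ eta_equiv (hr_lhs r) (HVar x)) /\
  (forall x, hfree x (hr_rhs r) -> hfree x (hr_lhs r)).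

(** [hstep R E a] relates terms of type [a] in [E].  The substitution ranges
    over HRS-terms; taking arbitrary typed terms would not change the relation,
    since instances are normalised anyway. *)
Inductive hstep (R : hrule -> Prop) : tenv -> sty -> relation hterm :=
| hstep_root E r s l' r' :
    R r ->
    (forall x, hrs_term E (s x) (hr_env r x)) ->
    long_nf E base (hsubst s (hr_lhs r)) l' ->
    long_nf E base (hsubst s (hr_rhs r)) r' ->
    hstep R E base l' r'
| hstep_lam E a b t t' :
    hstep R (scons a E) b t t' -> hstep R E (arr a b) (HLam t) (HLam t')
| hstep_app_l E a b t t' u :
    hstep R E (arr a b) t t' -> htyping E u a ->
    hstep R E b (HApp t u) (HApp t' u)
| hstep_app_r E a b t u u' :
    htyping E t (arr a b) -> hstep R E a u u' ->
    hstep R E b (HApp t u) (HApp t u').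

Definition hrewrite (R : hrule -> Prop) (E : tenv) (a : sty) : relation hterm :=
  fun t t' => hrs_term E t a /\ hrs_term E t' a /\ hstep R E a t t'.

Definition confluent {X : Type} (R : relation X) : Prop :=
  forall t t1 t2,
    clos_refl_trans X R t t1 -> clos_refl_trans X R t t2 ->
    exists t', clos_refl_trans X R t1 t' /\ clos_refl_trans X R t2 t'.

Definition hrs_confluent (R : hrule -> Prop) : Prop :=
  forall (E : tenv) (a : sty), confluent (hrewrite R E a).

(** [t] is of the form [x v1 ... vn] with [x] not in [V]. *)
Fixpoint flex (V : vset) (t : term) : bool :=
  match t with
  | Var x => negb (V x)
  | App t _ => flex V t
  | _ => false
  end.

Fixpoint encode (V : vset) (t : term) : hterm :=
  match t with
  | TKind => HCst hKind
  | TType => HCst hType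
  | Var x => HVar x
  | Cst c => HCst (hcst c)
  | TCst C => HCst (htcst C)
  | App u v =>
      if flex V u then HApp (encode V u) (encode V v)
      else HApp (HApp (HCst happ) (encode V u)) (encode V v)
  | Lam A u =>
      HApp (HApp (HCst hlam) (encode V A)) (HLam (encode (scons true V) u))
  | Pi A B =>
      HApp (HApp (HCst hpi) (encode V A)) (HLam (encode (scons true V) B))
  end.

(** [uniform_at ar V n t]: in [t], itself applied to [n] further arguments,
    every occurrence of a free variable [x] not in [V] has exactly [ar x]
    arguments. *)
Fixpoint uniform_at (ar : nat -> nat) (V : vset) (n : nat) (t : term) : Prop :=
  match t with
  | Var x => V x = false -> n = ar x
  | App t u => uniform_at ar V (S n) t /\ uniform_at ar V 0 u
  | Lam A t =>
      uniform_at ar V 0 A /\ uniform_at (scons 0 ar) (scons true V) 0 t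
  | Pi A B =>
      uniform_at ar V 0 A /\ uniform_at (scons 0 ar) (scons true V) 0 B
  | _ => True
  end.

Definition uniform (ar : nat -> nat) (V : vset) (t : term) : Prop :=
  uniform_at ar V 0 t.

(** The arity of a variable of [V] is irrelevant; [scons 0 ar] is [ar] on the
    variables that are not bound by the new binder. *)
Inductive lp_pattern : vset -> (nat -> nat) -> term -> Prop :=
| pat_cst V ar c : lp_pattern V ar (Cst c)
| pat_tcst V ar C : lp_pattern V ar (TCst C)
| pat_app V ar p q :
    lp_pattern V ar p -> lp_pattern V ar q -> lp_pattern V ar (App p q)
| pat_bound V ar x : V x = true -> lp_pattern V ar (Var x)
| pat_free V ar p x ys :
    lp_pattern V ar p ->
    V x = false ->
    NoDup ys -> Forall (fun y => V y = true) ys -> length ys = ar x ->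
    lp_pattern V ar (App p (apps (Var x) (map Var ys)))
| pat_lam V ar p A q :
    lp_pattern V ar p ->
    (forall x, free x A -> V x = true) ->
    lp_pattern (scons true V) (scons 0 ar) q ->
    lp_pattern V ar (App p (Lam A q)).

Definition encodable (u v : term) : Prop :=
  (exists ar, lp_pattern vempty ar u) /\
  (forall x, free x v -> free x u) /\
  (exists ar, uniform ar vempty u /\ uniform ar vempty v).

Definition encode_rule (ar : nat -> nat) (u v : term) : hrule :=
  HRule (fun x => tpow (ar x)) (encode vempty u) (encode vempty v).

(** app (lam X (fun x => Y x)) Z --> Y Z, with X, Y, Z of indices 0, 1, 2. *)
Definition hbeta_rule : hrule :=
  HRule
    (scons base (scons (arr base base) (fun _ => base)))
    (HApp (HApp (HCst happ)
             (HApp (HApp (HCst hlam) (HVar 0)) (HLam (HApp (HVar 2) (HVar 0)))))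
       (HVar 2))
    (HApp (HVar 1) (HVar 2)).

(** The arity function [ar] is determined by the rule on its free variables,
    the only ones whose type matters. *)
Inductive HRS (G : gctx) : hrule -> Prop :=
| HRS_beta : HRS G hbeta_rule
| HRS_rule u v ar :
    In (DRule u v) G -> uniform ar vempty u -> uniform ar vempty v ->
    HRS G (encode_rule ar u v).

Fixpoint has_cst (t : hterm) : Prop :=
  match t with
  | HVar _ => False
  | HCst _ => True
  | HApp t u => has_cst t \/ has_cst u
  | HLam t => has_cst t
  end.

Lemma has_cst_hrename r t : has_cst (hrename r t) <-> has_cst t.
Proof. revert r; induction t; simpl; firstorder. Qed.

Lemma has_cst_eta t u : eta_equiv t u -> has_cst t <-> has_cst u.
Proof.
  induction 1 as [t u H| | |]; try tauto.
  induction H as [t u H| | |]; simpl; try tauto.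
  destruct H; simpl; rewrite has_cst_hrename; tauto.
Qed.

Lemma hfree_encode V t x : hfree x (encode V t) <-> free x t.
Proof.
  revert V x; induction t; intros V x; simpl; try tauto.
  - destruct (flex V t1); simpl; rewrite IHt1, IHt2; tauto.
  - rewrite IHt1, IHt2; tauto.
  - rewrite IHt1, IHt2; tauto.
Qed.

Definition env_ok (ar : nat -> nat) (V : vset) (E : tenv) : Prop :=
  forall x, E x = if V x then base else tpow (ar x).

Lemma env_ok_scons ar V E :
  env_ok ar V E -> env_ok (scons 0 ar) (scons true V) (scons base E).
Proof. intros H [|x]; simpl; auto. Qed.

Lemma neutral_encode ar V E n t :
  env_ok ar V E -> uniform_at ar V n t ->
  neutral E (encode V t) (if flex V t then tpow n else base).
Proof.
  assert (base_of : forall V E t,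
    neutral E (encode V t) (if flex V t then tpow 0 else base) ->
    hrs_term E (encode V t) base).
  { intros V' E' t' H; constructor; simpl in H; destruct (flex V' t'); exact H. }
  revert ar V E n; induction t; intros ar V E n HE Hu; simpl in *;
    try apply (neutral_cst E).
  - replace (if negb (V i) then tpow n else base) with (E i) by
      (rewrite HE; destruct (V i); simpl; [|rewrite Hu]; auto).
    constructor.
  - destruct Hu as [H1 H2].
    specialize (IHt1 _ _ _ _ HE H1); specialize (IHt2 _ _ _ _ HE H2).
    destruct (flex V t1) eqn:F.
    + eapply neutral_app; [exact IHt1|]; apply base_of, IHt2.
    + repeat eapply neutral_app; [apply (neutral_cst E happ)| |].
      * constructor; exact IHt1.
      * apply base_of, IHt2.
  - destruct Hu as [H1 H2].
    repeat eapply neutral_app; [apply (neutral_cst E hlam)| |].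
    + apply base_of; exact (IHt1 _ _ _ 0 HE H1).
    + constructor; apply base_of.
      exact (IHt2 _ _ _ 0 (env_ok_scons _ _ _ HE) H2).
  - destruct Hu as [H1 H2].
    repeat eapply neutral_app; [apply (neutral_cst E hpi)| |].
    + apply base_of; exact (IHt1 _ _ _ 0 HE H1).
    + constructor; apply base_of.
      exact (IHt2 _ _ _ 0 (env_ok_scons _ _ _ HE) H2).
Qed.

Lemma hrs_term_encode ar V E t :
  env_ok ar V E -> uniform ar V t -> hrs_term E (encode V t) base.
Proof.
  intros HE Hu; pose proof (neutral_encode _ _ _ _ _ HE Hu) as H.
  constructor; simpl in H; destruct (flex V t); exact H.
Qed.

Lemma lp_pattern_rigid V ar p : lp_pattern V ar p -> flex V p = false.
Proof. induction 1; simpl; auto. rewrite H; reflexivity. Qed.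

Lemma lp_pattern_has_cst ar p :
  lp_pattern vempty ar p -> has_cst (encode vempty p).
Proof.
  remember vempty as V; induction 1; subst; simpl in *; auto;
    try (rewrite (lp_pattern_rigid _ _ _ H); simpl; tauto).
  discriminate.
Qed.

Lemma hpattern_closed E V t :
  (forall x, free x t -> V x = true) -> flex V t = false /\ hpattern E V (encode V t).
Proof.
  revert E V; induction t; intros E V H; simpl in *;
    try (split; [reflexivity|constructor]; fail).
  - rewrite H by reflexivity; split; [reflexivity|]; constructor; auto.
  - destruct (IHt1 E V) as [F1 P1]; [firstorder|].
    destruct (IHt2 E V) as [F2 P2]; [firstorder|].
    rewrite F1; split; [reflexivity|]; repeat constructor; auto.
  - destruct (IHt1 E V) as [F1 P1]; [firstorder|].
    destruct (IHt2 (scons base E) (scons true V)) as [F2 P2].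
    { intros [|x]; simpl; auto. }
    split; [reflexivity|]; repeat constructor; auto; econstructor; eauto.
  - destruct (IHt1 E V) as [F1 P1]; [firstorder|].
    destruct (IHt2 (scons base E) (scons true V)) as [F2 P2].
    { intros [|x]; simpl; auto. }
    split; [reflexivity|]; repeat constructor; auto; econstructor; eauto.
Qed.

Lemma encode_apps V t ys :
  flex V t = true ->
  encode V (apps t (map Var ys)) = happs (encode V t) (map HVar ys).
Proof.
  revert t; induction ys as [|y ys IH]; intros t F; simpl; auto.
  rewrite IH by exact F; simpl; rewrite F; reflexivity.
Qed.

Lemma htyping_happs E t ys :
  htyping E t (tpow (length ys)) -> Forall (fun y => E y = base) ys ->
  htyping E (happs t (map HVar ys)) base.
Proof.
  revert t; induction ys as [|y ys IH]; intros t Ht Hy; simpl in *; auto.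
  inversion Hy as [|y' ys' Ey Eys]; subst; apply IH; auto.
  eapply ht_app; [exact Ht|]; rewrite <- Ey; constructor.
Qed.

Lemma uniform_apps ar V n x ys :
  V x = false -> uniform_at ar V n (apps (Var x) (map Var ys)) ->
  length ys + n = ar x.
Proof.
  intros Hx.
  enough (gen : forall t m,
    (forall n, uniform_at ar V n t -> m + n = ar x) ->
    forall n, uniform_at ar V n (apps t (map Var ys)) ->
      length ys + m + n = ar x).
  { intros H; specialize (gen (Var x) 0).
    rewrite PeanoNat.Nat.add_0_r in gen; apply gen; auto. }
  induction ys as [|y ys IH]; intros t m Ht k H; simpl in *; auto.
  specialize (IH (App t (Var y)) (S m)).
  rewrite <- plus_n_Sm in IH; apply IH; auto.
  intros j [Hj _]; specialize (Ht _ Hj).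
  rewrite <- plus_n_Sm in Ht; exact Ht.
Qed.

Lemma hpattern_encode V ar' ar E n p :
  lp_pattern V ar' p -> env_ok ar V E -> uniform_at ar V n p ->
  hpattern E V (encode V p).
Proof.
  intros Hp; revert ar E n.
  induction Hp as [V ar' c|V ar' C|V ar' p q Hp IHp Hq IHq|V ar' x Hx
                  |V ar' p x ys Hp IHp Hx Hd Hb Hl
                  |V ar' p A q Hp IHp HA Hq IHq];
    intros ar E n HE Hu; simpl in *; try (constructor; auto; fail).
  - rewrite (lp_pattern_rigid _ _ _ Hp); destruct Hu.
    repeat constructor; eauto.
  - rewrite (lp_pattern_rigid _ _ _ Hp); destruct Hu as [Hu1 Hu2].
    repeat constructor; eauto.
    rewrite encode_apps by (simpl; rewrite Hx; reflexivity).
    apply hpat_free with (ys := ys); auto.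
    + apply htyping_happs.
      * apply uniform_apps in Hu2; auto.
        rewrite PeanoNat.Nat.add_0_r in Hu2; rewrite Hu2.
        replace (tpow (ar x)) with (E x) by (rewrite HE, Hx; reflexivity).
        constructor.
      * revert Hb; apply Forall_impl; intros y Hy; rewrite HE, Hy; reflexivity.
    + clear; induction ys; simpl; constructor; auto. apply rst_refl.
  - rewrite (lp_pattern_rigid _ _ _ Hp); destruct Hu as [Hu1 [_ Hu2]].
    repeat constructor; eauto.
    + apply hpattern_closed; auto.
    + apply hpat_lam with (a := base); eapply IHq; eauto.
      apply env_ok_scons; auto.
Qed.

Lemma HRS_is_hrs (G : gctx) :
  (forall u v, In (DRule u v) G -> encodable u v) ->
  forall r, HRS G r -> is_hrule r.
Proof.
  intros HG r [|u v ar Hin Hu Hv].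
  - set (E := hr_env hbeta_rule).
    assert (HX : hrs_term E (HVar 0) base)
      by (constructor; exact (neutral_var E 0)).
    assert (HZ : hrs_term E (HVar 2) base)
      by (constructor; exact (neutral_var E 2)).
    repeat split; simpl; fold E.
    + constructor; repeat eapply neutral_app;
        [exact (neutral_cst E happ)| |exact HZ].
      constructor; repeat eapply neutral_app;
        [exact (neutral_cst E hlam)|exact HX|].
      do 2 constructor; eapply neutral_app;
        [exact (neutral_var (scons base E) 2)|].
      constructor; exact (neutral_var (scons base E) 0).
    + constructor; eapply neutral_app; [exact (neutral_var E 1)|exact HZ].
    + repeat apply hpat_app; try apply hpat_cst.
      * apply (hpat_free E vempty 0 [] []); auto using NoDup_nil.
        exact (ht_var E 0).
      * apply hpat_lam with (a := base).
        apply (hpat_free (scons base E) (scons true vempty) 2 [HVar 0] [0]); auto.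
        -- eapply ht_app; [exact (ht_var (scons base E) 2)|].
           exact (ht_var (scons base E) 0).
        -- repeat constructor; apply rst_refl.
        -- repeat constructor; auto.
      * apply (hpat_free E vempty 2 [] []); auto using NoDup_nil.
        exact (ht_var E 2).
    + intros x H; apply has_cst_eta in H; simpl in H; tauto.
    + intros x [<-|<-]; tauto.
  - destruct (HG _ _ Hin) as [[ar' Hp] [Hfv _]].
    assert (HE : env_ok ar vempty (fun x => tpow (ar x)))
      by (intros x; reflexivity).
    repeat split; simpl.
    + exact (hrs_term_encode _ _ _ _ HE Hu).
    + exact (hrs_term_encode _ _ _ _ HE Hv).
    + exact (hpattern_encode _ _ _ _ _ _ Hp HE Hu).
    + intros x H; apply has_cst_eta in H; simpl in H; apply H.
      eapply lp_pattern_has_cst; eauto.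
    + intros x; rewrite !hfree_encode; auto.
Qed.

(* Main.v *)
Require Import Defs.
From Stdlib Require Import List Relations Lia PeanoNat.

(** Encode terms with all their variables of type [term].  Convertible terms
    have encodings convertible in the HRS, because an instance [s x] of a rule
    variable of arity [n] is represented by [fun y1 ... yn => app (... (s x) ...)
    yn].  By confluence, the encodings of two convertible products have a common
    reduct, and since no left-hand side can match a [pi], the reductions take
    place separately in the domains and in the codomains.  It remains to read
    reductions back: an HRS step on an encoding is matched, up to beta-reduction,
    by a step of the calculus.  This needs the uniqueness of the long normal form
    of the instances of a rule, that is, that [enc] is injective modulo untyped
    beta-eta, which follows from the Church-Rosser property of beta-eta. *)

(** * Confluence of untyped beta-eta-reduction *)

Lemma hrename_ext_free t r r' :
  (forall x, hfree x t -> r x = r' x) -> hrename r t = hrename r' t.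
Proof.
  revert r r'; induction t; simpl; intros r r' H; f_equal; auto.
  apply IHt; intros [|x] Hx; simpl; auto.
Qed.

Lemma hrename_id t r : (forall x, hfree x t -> r x = x) -> hrename r t = t.
Proof.
  revert r; induction t; simpl; intros r H; f_equal; auto.
  apply IHt; intros [|x] Hx; simpl; auto.
Qed.

Lemma hsubst_ext t s s' : (forall x, s x = s' x) -> hsubst s t = hsubst s' t.
Proof.
  revert s s'; induction t; simpl; intros s s' H; f_equal; auto.
  apply IHt; intros [|x]; simpl; auto. now rewrite H.
Qed.

Lemma hsubst_id t s : (forall x, s x = HVar x) -> hsubst s t = t.
Proof.
  revert s; induction t; simpl; intros s H; f_equal; auto.
  apply IHt; intros [|x]; simpl; auto. now rewrite H.
Qed.

Lemma hrename_hrename t r r' :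
  hrename r (hrename r' t) = hrename (fun x => r (r' x)) t.
Proof.
  revert r r'; induction t; simpl; intros r r'; f_equal; auto.
  rewrite IHt; apply hrename_ext_free; intros [|x]; auto.
Qed.

Lemma hsubst_hrename t s r : hsubst s (hrename r t) = hsubst (fun x => s (r x)) t.
Proof.
  revert s r; induction t; simpl; intros s r; f_equal; auto.
  rewrite IHt; apply hsubst_ext; intros [|x]; auto.
Qed.

Lemma hrename_hsubst t s r :
  hrename r (hsubst s t) = hsubst (fun x => hrename r (s x)) t.
Proof.
  revert s r; induction t; simpl; intros s r; f_equal; auto.
  rewrite IHt; apply hsubst_ext; intros [|x]; simpl; auto.
  now rewrite !hrename_hrename.
Qed.

Lemma hsubst_hsubst t s s' :
  hsubst s (hsubst s' t) = hsubst (fun x => hsubst s (s' x)) t.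
Proof.
  revert s s'; induction t; simpl; intros s s'; f_equal; auto.
  rewrite IHt; apply hsubst_ext; intros [|x]; simpl; auto.
  now rewrite hsubst_hrename, hrename_hsubst.
Qed.

Lemma hsubst1_hrename u t : hsubst1 u (hrename S t) = t.
Proof. unfold hsubst1; rewrite hsubst_hrename; now apply hsubst_id. Qed.

Lemma hrename_hsubst1 r u t :
  hrename r (hsubst1 u t) = hsubst1 (hrename r u) (hrename (up_ren r) t).
Proof.
  unfold hsubst1; rewrite hrename_hsubst, hsubst_hrename.
  apply hsubst_ext; intros [|x]; auto.
Qed.

Lemma hsubst_hsubst1 s u t :
  hsubst s (hsubst1 u t) = hsubst1 (hsubst s u) (hsubst (hup s) t).
Proof.
  unfold hsubst1; rewrite !hsubst_hsubst.
  apply hsubst_ext; intros [|x]; simpl; auto.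
  now rewrite hsubst_hrename, hsubst_id.
Qed.

Lemma hrename_shift r t : hrename (up_ren r) (hrename S t) = hrename S (hrename r t).
Proof. now rewrite !hrename_hrename. Qed.

Lemma hsubst_shift s t : hsubst (hup s) (hrename S t) = hrename S (hsubst s t).
Proof. now rewrite hsubst_hrename, hrename_hsubst. Qed.

Lemma hrename_pred t : hrename pred (hrename S t) = t.
Proof. rewrite hrename_hrename; now apply hrename_id. Qed.

Lemma hrename_S_inj t u : hrename S t = hrename S u -> t = u.
Proof. intros H; rewrite <- (hrename_pred t), H; apply hrename_pred. Qed.

Lemma hfree_hrename r t x : hfree x t -> hfree (r x) (hrename r t).
Proof.
  revert r x; induction t; simpl; intros r x H; auto.
  - destruct H; auto.
  - exact (IHt (up_ren r) (S x) H).
Qed.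

Lemma hfree_hrename_inv r t y :
  hfree y (hrename r t) -> exists x, hfree x t /\ y = r x.
Proof.
  revert r y; induction t; simpl; intros r y H; try tauto.
  - eauto.
  - destruct H as [H|H]; [apply IHt1 in H|apply IHt2 in H];
      destruct H as [x []]; eauto.
  - apply IHt in H; destruct H as [[|x] [H E]]; simpl in E; try discriminate.
    injection E; eauto.
Qed.

(** The index 0 is fixed by [up_ren r] and absent from a shifted term, so it is not free in [t],
    which is therefore a shift itself. This recovers an eta-redex from its image under a
    renaming. *)
Lemma hrename_up_shift_inv r t u :
  hrename (up_ren r) t = hrename S u ->
  exists v, t = hrename S v /\ u = hrename r v.
Proof.
  intros H.
  assert (Ht : t = hrename S (hrename pred t)).
  { rewrite hrename_hrename; symmetry; apply hrename_id.
    intros [|x] Hx; auto.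
    apply (hfree_hrename (up_ren r)) in Hx; rewrite H in Hx.
    apply hfree_hrename_inv in Hx; destruct Hx as [? [_ [=]]]. }
  exists (hrename pred t); split; auto.
  rewrite Ht, hrename_shift in H; symmetry; now apply hrename_S_inj.
Qed.

(** * Parallel beta-eta-reduction and its diamond property *)

Fixpoint hsize (t : hterm) : nat :=
  match t with
  | HVar _ | HCst _ => 1
  | HApp t u => S (hsize t + hsize u)
  | HLam t => S (hsize t)
  end.

Lemma hsize_hrename r t : hsize (hrename r t) = hsize t.
Proof. revert r; induction t; simpl; auto. Qed.

(** Parallel reduction in the style of Tait and Martin-Löf, extended with eta: disjoint and nested
    redexes of both kinds may be contracted at once. *)
Inductive par : relation hterm :=
| par_var i : par (HVar i) (HVar i)
| par_cst k : par (HCst k) (HCst k)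
| par_app t t' u u' : par t t' -> par u u' -> par (HApp t u) (HApp t' u')
| par_lam t t' : par t t' -> par (HLam t) (HLam t')
| par_beta t t' u u' :
    par t t' -> par u u' -> par (HApp (HLam t) u) (hsubst1 u' t')
| par_eta t t' : par t t' -> par (HLam (HApp (hrename S t) (HVar 0))) t'.

Lemma par_refl t : par t t.
Proof. induction t; constructor; auto. Qed.

Lemma par_hrename r t t' : par t t' -> par (hrename r t) (hrename r t').
Proof.
  intros H; revert r; induction H; intros r; simpl; try (constructor; auto; fail).
  - rewrite hrename_hsubst1; constructor; auto.
  - rewrite hrename_shift; constructor; auto.
Qed.

Lemma par_hsubst s s' t t' :
  (forall x, par (s x) (s' x)) -> par t t' -> par (hsubst s t) (hsubst s' t').
Proof.
  intros Hs H; revert s s' Hs.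
  assert (Hup : forall s s', (forall x, par (s x) (s' x)) ->
                             forall x, par (hup s x) (hup s' x)).
  { intros s s' Hs [|x]; simpl; [constructor|apply par_hrename, Hs]. }
  induction H; intros s s' Hs; simpl; try (constructor; auto; fail); auto.
  - rewrite hsubst_hsubst1; constructor; auto.
  - rewrite hsubst_shift; constructor; auto.
Qed.

Lemma par_hsubst1 t t' u u' :
  par t t' -> par u u' -> par (hsubst1 u t) (hsubst1 u' t').
Proof. intros; apply par_hsubst; auto. intros [|x]; simpl; auto; constructor. Qed.

(** Renamings reflect redexes. This is what allows reductions of the shifted function of an
    eta-redex to be pulled back to the function itself. *)
Lemma par_hrename_inv r t z :
  par (hrename r t) z -> exists z', z = hrename r z' /\ par t z'.
Proof.
  intros H; remember (hrename r t) as y eqn:E; revert r t E.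
  induction H as [i|k|f f' u u' Hf IHf Hu IHu|b b' Hb IHb
                 |b b' u u' Hb IHb Hu IHu|b b' Hb IHb];
    intros r [j|k'|t1 t2|t1] E; simpl in E; try discriminate.
  - injection E as ->; exists (HVar j); split; [auto|constructor].
  - injection E as ->; exists (HCst k'); split; [auto|constructor].
  - injection E as -> ->.
    destruct (IHf _ _ eq_refl) as [z1 [-> H1]], (IHu _ _ eq_refl) as [z2 [-> H2]].
    exists (HApp z1 z2); split; [auto|constructor; auto].
  - injection E as ->; destruct (IHb _ _ eq_refl) as [z1 [-> H1]].
    exists (HLam z1); split; [auto|constructor; auto].
  - destruct t1 as [| | |t1]; try discriminate; injection E as -> ->.
    destruct (IHb _ _ eq_refl) as [z1 [-> H1]], (IHu _ _ eq_refl) as [z2 [-> H2]].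
    exists (hsubst1 z2 z1); rewrite hrename_hsubst1; split; [auto|constructor; auto].
  - destruct t1 as [| |t1 [[|j]| | |]|]; try discriminate; injection E as E.
    symmetry in E; apply hrename_up_shift_inv in E; destruct E as [v [-> ->]].
    destruct (IHb _ _ eq_refl) as [z1 [-> H1]].
    exists z1; split; [auto|constructor; auto].
Qed.

(** The two ways to reduce the body of an eta-redex: inside [c], or, when [c] is an abstraction, by
    the overlapping beta-redex, where the shift and the substitution of index 0 cancel. *)
Lemma par_shift_app_inv c b :
  par (HApp (hrename S c) (HVar 0)) b ->
  (exists c', b = HApp (hrename S c') (HVar 0) /\ par c c') \/
  (exists d, c = HLam d /\ par d b).
Proof.
  intros H; inversion H as [| |f f' u u' Hf Hu E1 E2| |d d' u u' Hd Hu E1 E2|]; subst.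
  - left; apply par_hrename_inv in Hf; destruct Hf as [c' [-> Hc]].
    inversion Hu; subst; eauto.
  - right; destruct c as [| | |c]; try discriminate; injection E1 as ->.
    apply par_hrename_inv in Hd; destruct Hd as [b [-> Hd]].
    inversion Hu; subst; exists c; split; auto.
    replace (hsubst1 _ _) with b; auto.
    unfold hsubst1; rewrite hsubst_hrename; symmetry; apply hsubst_id.
    intros [|x]; auto.
Qed.

(** Induction on size, because the overlaps of beta and eta call for the diamond on terms that are
    not literal subterms: the unshifted function of an eta-redex, or a smaller beta-redex. *)
Lemma par_diamond t t1 t2 : par t t1 -> par t t2 -> exists t3, par t1 t3 /\ par t2 t3.
Proof.
  remember (S (hsize t)) as n eqn:En.
  assert (Hn : hsize t < n) by lia; clear En.
  revert t t1 t2 Hn; induction n as [|n IH]; intros t t1 t2 Hn H1 H2; [lia|].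
  (* Reduction under the abstraction against eta. If the body is also a beta-redex, then [c] is an
     abstraction and [HLam b1] is already one of its reducts, so the induction hypothesis for [c]
     applies. *)
  assert (lam_eta : forall c b1 c2,
    hsize c < n -> par (HApp (hrename S c) (HVar 0)) b1 -> par c c2 ->
    exists t3, par (HLam b1) t3 /\ par c2 t3).
  { intros c b1 c2 Hs Hb Hc.
    apply par_shift_app_inv in Hb; destruct Hb as [[c1 [-> Hc1]]|[d [-> Hd]]].
    - destruct (IH _ _ _ Hs Hc1 Hc) as [c3 []].
      exists c3; split; [constructor|]; auto.
    - exact (IH _ _ _ Hs (par_lam _ _ Hd) Hc). }
  (* Separate reduction of function and argument against beta. If the function [HLam a] is an
     eta-redex for an abstraction [HLam d], both sides are reducts of the smaller redex
     [HApp (HLam d) u]. *)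
  assert (app_beta : forall a u f1 u1 a2 u2,
    S (S (hsize a + hsize u)) <= n ->
    par (HLam a) f1 -> par u u1 -> par a a2 -> par u u2 ->
    exists t3, par (HApp f1 u1) t3 /\ par (hsubst1 u2 a2) t3).
  { intros a u f1 u1 a2 u2 Hs Hf Hu1 Ha Hu2.
    destruct (IH u _ _ ltac:(lia) Hu1 Hu2) as [u3 []].
    inversion Hf as [| | |a' a1 Ha1| |c c1 Hc]; subst.
    - destruct (IH a _ _ ltac:(lia) Ha1 Ha) as [a3 []].
      exists (hsubst1 u3 a3); split; [constructor; auto|apply par_hsubst1; auto].
    - simpl in Hs; rewrite hsize_hrename in Hs.
      apply par_shift_app_inv in Ha; destruct Ha as [[c2 [-> Hc2]]|[d [-> Hd]]].
      + destruct (IH c _ _ ltac:(lia) Hc Hc2) as [c3 []].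
        exists (HApp c3 u3); split; [constructor; auto|].
        unfold hsubst1; simpl; fold (hsubst1 u2 (hrename S c2)).
        rewrite hsubst1_hrename; constructor; auto.
      + apply (IH (HApp (HLam d) u)); simpl in *; try lia; constructor; auto. }
  inversion H1 as [|k1|f f1 u u1 Hf1 Hu1|b b1 Hb1|b b1 u u1 Hb1 Hu1|c c1 Hc1]; subst;
    inversion H2 as [|k2|f' f2 u' u2 Hf2 Hu2|b' b2 Hb2|b' b2 u' u2 Hb2 Hu2|c' c2 Hc2];
    subst; simpl in Hn; rewrite ?hsize_hrename in Hn.
  - eexists; split; constructor.
  - eexists; split; constructor.
  - destruct (IH f _ _ ltac:(lia) Hf1 Hf2) as [f3 []].
    destruct (IH u _ _ ltac:(lia) Hu1 Hu2) as [u3 []].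
    exists (HApp f3 u3); split; constructor; auto.
  - eapply app_beta; eauto; lia.
  - destruct (IH b _ _ ltac:(lia) Hb1 Hb2) as [b3 []].
    exists (HLam b3); split; constructor; auto.
  - eapply lam_eta; eauto; lia.
  - destruct (app_beta b u f2 u2 b1 u1) as [t3 []]; eauto; lia.
  - destruct (IH b _ _ ltac:(lia) Hb1 Hb2) as [b3 []].
    destruct (IH u _ _ ltac:(lia) Hu1 Hu2) as [u3 []].
    exists (hsubst1 u3 b3); split; apply par_hsubst1; auto.
  - destruct (lam_eta c b2 t1) as [t3 []]; eauto; lia.
  - apply hrename_S_inj in H; subst; eapply (IH c); eauto; lia.
Qed.

(** * From the diamond property to joinability of convertible terms *)

Lemma diamond_confluent {X : Type} (R : relation X) :
  (forall t t1 t2, R t t1 -> R t t2 -> exists t3, R t1 t3 /\ R t2 t3) ->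
  confluent R.
Proof.
  intros HR.
  assert (strip : forall t t1 t2, R t t1 -> clos_refl_trans X R t t2 ->
            exists t3, clos_refl_trans X R t1 t3 /\ R t2 t3).
  { intros t t1 t2 H1 H2; apply clos_rt_rt1n in H2; revert t1 H1.
    induction H2 as [t|t t' t2 H H2 IH]; intros t1 H1.
    - exists t1; split; auto; apply rt_refl.
    - destruct (HR _ _ _ H1 H) as [t3 [A B]], (IH _ B) as [t4 []].
      exists t4; split; auto; eapply rt_trans; eauto using rt_step. }
  intros t t1 t2 H1 H2; apply clos_rt_rt1n in H1; revert t2 H2.
  induction H1 as [t|t t' t1 H H1 IH]; intros t2 H2.
  - exists t2; split; auto; apply rt_refl.
  - destruct (strip _ _ _ H H2) as [t3 [A B]], (IH _ A) as [t4 []].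
    exists t4; split; auto; eapply rt_trans; eauto using rt_step.
Qed.

Lemma confluent_joinable {X : Type} (R : relation X) t u :
  confluent R -> clos_refl_sym_trans X R t u ->
  exists z, clos_refl_trans X R t z /\ clos_refl_trans X R u z.
Proof.
  intros HR; induction 1 as [t u H|t|t u H IH|t u v H1 IH1 H2 IH2].
  - exists u; split; [apply rt_step; auto|apply rt_refl].
  - exists t; split; apply rt_refl.
  - destruct IH as [z []]; eauto.
  - destruct IH1 as [z1 [A1 B1]], IH2 as [z2 [A2 B2]].
    destruct (HR _ _ _ B1 A2) as [z []].
    exists z; split; eapply rt_trans; eauto.
Qed.

Lemma clos_rst_incl {X : Type} (R R' : relation X) :
  inclusion X R R' ->
  inclusion X (clos_refl_sym_trans X R) (clos_refl_sym_trans X R').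
Proof.
  intros HR t u; induction 1; eauto using rst_step, rst_refl, rst_sym, rst_trans.
Qed.

Lemma beta_eta_par t u :
  hctx_closure (union hterm hbeta_root heta_root) t u -> par t u.
Proof.
  induction 1 as [t u [[]|[]]| | |]; constructor; auto using par_refl.
Qed.

Lemma beta_eta_joinable t u :
  beta_eta_equiv t u ->
  exists z, clos_refl_trans hterm par t z /\ clos_refl_trans hterm par u z.
Proof.
  intros H; apply confluent_joinable.
  - apply diamond_confluent, par_diamond.
  - revert H; apply clos_rst_incl; exact beta_eta_par.
Qed.

(** * Encoding with all variables of base type *)

(** [encode V] when all variables belong to [V]. *)
Fixpoint enc (t : term) : hterm :=
  match t with
  | TKind => HCst hKind
  | TType => HCst hType
  | Var x => HVar x
  | Cst c => HCst (hcst c)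
  | TCst C => HCst (htcst C)
  | App u v => HApp (HApp (HCst happ) (enc u)) (enc v)
  | Lam A u => HApp (HApp (HCst hlam) (enc A)) (HLam (enc u))
  | Pi A B => HApp (HApp (HCst hpi) (enc A)) (HLam (enc B))
  end.

(** The eta-reducts of [enc t]: the body of a binder may have lost its
    abstraction. *)
Inductive eta_enc : term -> hterm -> Prop :=
| eta_enc_kind : eta_enc TKind (HCst hKind)
| eta_enc_type : eta_enc TType (HCst hType)
| eta_enc_var x : eta_enc (Var x) (HVar x)
| eta_enc_cst c : eta_enc (Cst c) (HCst (hcst c))
| eta_enc_tcst C : eta_enc (TCst C) (HCst (htcst C))
| eta_enc_app u v a b :
    eta_enc u a -> eta_enc v b ->
    eta_enc (App u v) (HApp (HApp (HCst happ) a) b)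
| eta_enc_lam A u a b :
    eta_enc A a -> eta_enc u b ->
    eta_enc (Lam A u) (HApp (HApp (HCst hlam) a) (HLam b))
| eta_enc_lam_eta A u a b :
    eta_enc A a -> eta_enc u (HApp (hrename S b) (HVar 0)) ->
    eta_enc (Lam A u) (HApp (HApp (HCst hlam) a) b)
| eta_enc_pi A B a b :
    eta_enc A a -> eta_enc B b ->
    eta_enc (Pi A B) (HApp (HApp (HCst hpi) a) (HLam b))
| eta_enc_pi_eta A B a b :
    eta_enc A a -> eta_enc B (HApp (hrename S b) (HVar 0)) ->
    eta_enc (Pi A B) (HApp (HApp (HCst hpi) a) b).

Lemma eta_enc_enc t : eta_enc t (enc t).
Proof. induction t; simpl; constructor; auto. Qed.

Lemma par_cst_app_inv k a b z :
  par (HApp (HApp (HCst k) a) b) z ->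
  exists a' b', z = HApp (HApp (HCst k) a') b' /\ par a a' /\ par b b'.
Proof.
  intros H; inversion H as [| |f f' u u' Hf Hu| | |]; subst.
  inversion Hf as [| |g g' v v' Hg Hv| | |]; subst.
  inversion Hg; subst; eauto.
Qed.

(** Every application has a constant at the head of its spine, so no beta-redex is present; the only
    contraction possible is the eta-contraction of the body of a binder, which [eta_enc] allows. *)
Lemma eta_enc_par t z z' : eta_enc t z -> par z z' -> eta_enc t z'.
Proof.
  intros H; revert z'; induction H; intros z' Hz;
    try (inversion Hz; subst; constructor; fail);
    apply par_cst_app_inv in Hz; destruct Hz as [a' [b' [-> [Ha Hb]]]];
    try (constructor; auto; fail).
  - inversion Hb; subst; [constructor; auto|apply eta_enc_lam_eta; auto].
    apply IHeta_enc2; constructor; [now apply par_hrename|constructor].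
  - apply eta_enc_lam_eta; auto.
    apply IHeta_enc2; constructor; [now apply par_hrename|constructor].
  - inversion Hb; subst; [constructor; auto|apply eta_enc_pi_eta; auto].
    apply IHeta_enc2; constructor; [now apply par_hrename|constructor].
  - apply eta_enc_pi_eta; auto.
    apply IHeta_enc2; constructor; [now apply par_hrename|constructor].
Qed.

(** The two forms of a binder overlap only when the body is an abstraction; read as an eta-reduced
    body, it would require a beta-redex to be in the image of [eta_enc]. *)
Lemma eta_enc_functional t u z : eta_enc t z -> eta_enc u z -> t = u.
Proof.
  intros H; revert u; induction H; intros w Hw; inversion Hw; subst; auto;
    try (f_equal; auto; fail);
    match goal with
    | H : eta_enc _ (HApp (hrename S (HLam _)) _) |- _ => inversion H
    end.
Qed.

(** A common parallel reduct of the two encodings still determines both terms, by preservation and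
    functionality of [eta_enc]. *)
Lemma enc_inj_beta_eta t u : beta_eta_equiv (enc t) (enc u) -> t = u.
Proof.
  intros H; apply beta_eta_joinable in H; destruct H as [z [H1 H2]].
  assert (pres : forall t a b,
    clos_refl_trans hterm par a b -> eta_enc t a -> eta_enc t b).
  { intros v a b; induction 1; eauto using eta_enc_par. }
  apply (eta_enc_functional t u z);
    [apply (pres t (enc t))|apply (pres u (enc u))]; auto using eta_enc_enc.
Qed.

(** * Congruence of beta-eta-equivalence, and encoding of substitutions *)

Lemma clos_rst_map {X Y : Type} (R : relation X) (R' : relation Y) (f : X -> Y) :
  (forall t u, R t u -> R' (f t) (f u)) ->
  forall t u, clos_refl_sym_trans X R t u -> clos_refl_sym_trans Y R' (f t) (f u).
Proof.
  intros HR t u; induction 1; eauto using rst_step, rst_refl, rst_sym, rst_trans.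
Qed.

Lemma clos_rt_map {X Y : Type} (R : relation X) (R' : relation Y) (f : X -> Y) :
  (forall t u, R t u -> R' (f t) (f u)) ->
  forall t u, clos_refl_trans X R t u -> clos_refl_trans Y R' (f t) (f u).
Proof. intros HR t u; induction 1; eauto using rt_step, rt_refl, rt_trans. Qed.

Lemma beta_eta_app t t' u u' :
  beta_eta_equiv t t' -> beta_eta_equiv u u' ->
  beta_eta_equiv (HApp t u) (HApp t' u').
Proof.
  intros H1 H2; apply rst_trans with (HApp t' u).
  - revert H1; apply (clos_rst_map _ _ (fun t => HApp t u)); intros.
    now apply hctx_app_l.
  - revert H2; apply clos_rst_map; intros; now apply hctx_app_r.
Qed.

Lemma beta_eta_lam t t' :
  beta_eta_equiv t t' -> beta_eta_equiv (HLam t) (HLam t').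
Proof. apply clos_rst_map; intros; now apply hctx_lam. Qed.

Lemma beta_eta_beta t u : beta_eta_equiv (HApp (HLam t) u) (hsubst1 u t).
Proof. apply rst_step, hctx_root; left; constructor. Qed.

Lemma beta_eta_app2 k a a' b b' :
  beta_eta_equiv a a' -> beta_eta_equiv b b' ->
  beta_eta_equiv (HApp (HApp (HCst k) a) b) (HApp (HApp (HCst k) a') b').
Proof. intros; repeat apply beta_eta_app; auto; apply rst_refl. Qed.

Lemma enc_rename r t : enc (rename r t) = hrename r (enc t).
Proof. revert r; induction t; intros r; simpl; congruence. Qed.

Lemma enc_subst s hs t :
  (forall x, hs x = enc (s x)) -> enc (subst s t) = hsubst hs (enc t).
Proof.
  revert s hs; induction t; intros s hs H; simpl; repeat f_equal; auto.
  all: apply IHt2; intros [|x]; simpl; auto; now rewrite enc_rename, H.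
Qed.

Lemma enc_subst1 u t : enc (subst1 u t) = hsubst1 (enc u) (enc t).
Proof. apply enc_subst; intros [|x]; auto. Qed.

(* Typing and shape of HRS-terms over variables of base type *)
Scheme hrs_term_mut := Minimality for hrs_term Sort Prop
with neutral_mut := Minimality for neutral Sort Prop.
Combined Scheme hrs_neutral_ind from hrs_term_mut, neutral_mut.

Lemma hrs_neutral_htyping :
  (forall E t a, hrs_term E t a -> htyping E t a) /\
  (forall E t a, neutral E t a -> htyping E t a).
Proof. apply hrs_neutral_ind; intros; auto; econstructor; eauto. Qed.

Lemma hrs_term_htyping E t a : hrs_term E t a -> htyping E t a.
Proof. apply hrs_neutral_htyping. Qed.

Lemma htyping_hrename E E' r t a :
  htyping E t a -> (forall x, E' (r x) = E x) -> htyping E' (hrename r t) a.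
Proof.
  intros H; revert E' r; induction H; intros E' r HE; simpl.
  - rewrite <- HE; constructor.
  - constructor.
  - econstructor; eauto.
  - constructor; apply IHhtyping; intros [|x]; simpl; auto.
Qed.

Lemma htyping_hsubst E E' s t a :
  htyping E t a -> (forall x, htyping E' (s x) (E x)) -> htyping E' (hsubst s t) a.
Proof.
  intros H; revert E' s; induction H; intros E' s HE; simpl; auto.
  - constructor.
  - econstructor; eauto.
  - constructor; apply IHhtyping; intros [|x]; simpl.
    + exact (ht_var (scons a E') 0).
    + eapply htyping_hrename; eauto.
Qed.

Definition all_base (E : tenv) : Prop := forall x, E x = base.

Lemma all_base_scons E : all_base E -> all_base (scons base E).
Proof. intros H [|x]; simpl; auto. Qed.

Lemma neutral_cst_app2 E k a b ta tb :
  hconst_type k = arr ta (arr tb base) ->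
  hrs_term E a ta -> hrs_term E b tb ->
  hrs_term E (HApp (HApp (HCst k) a) b) base.
Proof.
  intros Hk Ha Hb; constructor; repeat (eapply neutral_app; eauto).
  rewrite <- Hk; constructor.
Qed.

Lemma hrs_term_enc E t : all_base E -> hrs_term E (enc t) base.
Proof.
  revert E; induction t; intros E HE; simpl;
    try (eapply neutral_cst_app2; [reflexivity| |];
         try apply hrs_lam; auto using all_base_scons; fail);
    constructor; try apply (neutral_cst E).
  rewrite <- (HE i); constructor.
Qed.

(** Left inverse of [enc], on arbitrary HRS-terms; the abstractions that are not
    the body of a [lam] or [pi] get a dummy type annotation. *)
Fixpoint dec (z : hterm) : term :=
  match z with
  | HVar x => Var x
  | HCst hKind => TKind
  | HCst hType => TType
  | HCst (hcst c) => Cst c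
  | HCst (htcst C) => TCst C
  | HApp (HApp (HCst happ) a) b => App (dec a) (dec b)
  | HApp (HApp (HCst hlam) a) (HLam b) => Lam (dec a) (dec b)
  | HApp (HApp (HCst hpi) a) (HLam b) => Pi (dec a) (dec b)
  | HLam z => Lam (TCst 0) (dec z)
  | _ => TKind
  end.

Lemma dec_enc t : dec (enc t) = t.
Proof. induction t; simpl; congruence. Qed.

(** The possible values of a rule variable of arity [n]: an encoding under [n] abstractions of the
    HRS, imitated in the calculus by [n] abstractions. Their dummy annotation [TCst 0] disappears
    once the variable has received its arguments and the redexes are contracted. *)
Inductive abs : nat -> term -> hterm -> Prop :=
| abs_0 t : abs 0 t (enc t)
| abs_S n t z : abs n t z -> abs (S n) (Lam (TCst 0) t) (HLam z).

Lemma abs_rename n t z r : abs n t z -> abs n (rename r t) (hrename r z).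
Proof.
  intros H; revert r; induction H; intros r; simpl.
  - rewrite <- enc_rename; constructor.
  - constructor; auto.
Qed.

Lemma abs_subst n t z s hs :
  abs n t z -> (forall x, hs x = enc (s x)) -> abs n (subst s t) (hsubst hs z).
Proof.
  intros H; revert s hs; induction H; intros s hs Hs; simpl.
  - rewrite <- (enc_subst s) by auto; constructor.
  - constructor; apply IHabs; intros [|x]; simpl; auto.
    now rewrite Hs, enc_rename.
Qed.

Lemma abs_subst1 n t z u : abs n t z -> abs n (subst1 u t) (hsubst1 (enc u) z).
Proof. intros H; eapply abs_subst; eauto. intros [|x]; auto. Qed.

(** With no variable of function type, a neutral spine is either complete, hence an encoding, or a
    bare constant of function type, or [app], [lam] or [pi] lacking only its last argument. *)
Lemma hrs_neutral_enc :
  (forall E z a, hrs_term E z a -> all_base E ->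
     forall n, a = tpow n -> abs n (dec z) z) /\
  (forall E z a, neutral E z a -> all_base E ->
     a = base /\ (exists t, z = enc t) \/
     a <> base /\ (exists k, z = HCst k /\ a = hconst_type k) \/
     (exists t, z = HApp (HCst happ) (enc t)) /\ a = arr base base \/
     (exists t, z = HApp (HCst hlam) (enc t) \/ z = HApp (HCst hpi) (enc t)) /\
       a = arr (arr base base) base).
Proof.
  apply hrs_neutral_ind.
  - intros E t a b _ IH HE [|n]; [discriminate|intros [= -> ->]].
    simpl; constructor; auto using all_base_scons.
  - intros E t _ IH HE [|n] Hn; [|discriminate].
    destruct (IH HE) as [[_ [u ->]]|[[N _]|[[_ [=]]|[_ [=]]]]]; [|easy].
    rewrite dec_enc; constructor.
  - intros E i HE; left; split; [apply HE|exists (Var i); auto].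
  - intros E k HE; destruct k; simpl; try (right; left; split; [|eauto]; easy); left.
    + split; auto; exists TType; auto.
    + split; auto; exists TKind; auto.
    + split; auto; exists (Cst c); auto.
    + split; auto; exists (TCst C); auto.
  - intros E t u a b _ IHt _ IHu HE; specialize (IHu HE).
    destruct (IHt HE) as [[[=] _]|[[_ [k [-> Hk]]]|[[[v ->] [= -> ->]]
                           |[[v Hv] [= -> ->]]]]].
    + right; right.
      assert (Hu : a = base -> exists w, u = enc w).
      { intros ->; specialize (IHu 0 eq_refl); inversion IHu; eauto. }
      destruct k; simpl in Hk; try discriminate; injection Hk as -> ->;
        destruct Hu as [w ->]; auto.
      * left; eauto.
      * right; eauto.
      * right; eauto.
    + left; split; auto; specialize (IHu 0 eq_refl); inversion IHu; subst.
      exists (App v (dec u)); auto.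
    + left; split; auto; specialize (IHu 1 eq_refl).
      inversion IHu as [|n w z Hw]; subst; inversion Hw; subst.
      destruct Hv as [-> | ->]; [exists (Lam v w)|exists (Pi v w)]; auto.
Qed.

Lemma hrs_term_abs E z n :
  all_base E -> hrs_term E z (tpow n) -> abs n (dec z) z.
Proof. intros HE H; eapply hrs_neutral_enc; eauto. Qed.

Lemma hrs_term_base_enc E z : all_base E -> hrs_term E z base -> z = enc (dec z).
Proof. intros HE H; apply (hrs_term_abs E z 0) in H; auto; inversion H; congruence. Qed.

(** * From conversion to HRS steps *)

(** Turns [h] of base type into an [n]-ary function of the HRS: applied to [n] arguments it
    beta-reduces to nested [app] nodes with [h] at the head. *)
Fixpoint happ_eta (n : nat) (h : hterm) : hterm :=
  match n with
  | O => h
  | S n => HLam (happ_eta n (HApp (HApp (HCst happ) (hrename S h)) (HVar 0)))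
  end.

Lemma hrename_happ_eta r n h :
  hrename r (happ_eta n h) = happ_eta n (hrename r h).
Proof.
  revert r h; induction n; intros r h; simpl; auto.
  rewrite IHn; simpl; now rewrite hrename_shift.
Qed.

Lemma hsubst_happ_eta s n h : hsubst s (happ_eta n h) = happ_eta n (hsubst s h).
Proof.
  revert s h; induction n; intros s h; simpl; auto.
  rewrite IHn; simpl; now rewrite hsubst_shift.
Qed.

Lemma happ_eta_beta n h u :
  beta_eta_equiv (HApp (happ_eta (S n) h) u)
                 (happ_eta n (HApp (HApp (HCst happ) h) u)).
Proof.
  eapply rst_trans; [apply beta_eta_beta|].
  unfold hsubst1; rewrite hsubst_happ_eta; simpl.
  fold (hsubst1 u (hrename S h)); rewrite hsubst1_hrename; apply rst_refl.
Qed.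

Lemma hrs_term_happ_eta E n t :
  all_base E -> hrs_term E (happ_eta n (enc t)) (tpow n).
Proof.
  revert E t; induction n; intros E t HE; simpl.
  - now apply hrs_term_enc.
  - constructor; rewrite <- enc_rename.
    apply (IHn _ (App (rename S t) (Var 0))); now apply all_base_scons.
Qed.

(** Each application headed by a rule variable becomes a beta-redex that consumes one abstraction of
    [happ_eta]; [n] counts the arguments still to come, hence the abstractions left over. *)
Lemma encode_subst ar V n t s hs :
  uniform_at ar V n t ->
  (forall x, hs x = happ_eta (if V x then 0 else ar x) (enc (s x))) ->
  beta_eta_equiv (hsubst hs (encode V t))
    (happ_eta (if flex V t then n else 0) (enc (subst s t))).
Proof.
  assert (Hup : forall (ar : nat -> nat) (V : vset) s hs,
    (forall x, hs x = happ_eta (if V x then 0 else ar x) (enc (s x))) ->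
    forall x, hup hs x =
      happ_eta (if scons true V x then 0 else scons 0 ar x) (enc (up s x))).
  { clear; intros ar V s hs H [|x]; simpl; auto.
    now rewrite H, hrename_happ_eta, enc_rename. }
  assert (H0 : forall (b : bool) h, happ_eta (if b then 0 else 0) h = h)
    by (intros []; auto).
  revert ar V n s hs; induction t; intros ar V n s hs Hu Hs; simpl in *;
    try apply rst_refl.
  - rewrite Hs; destruct (V i); simpl; [|rewrite Hu by auto]; apply rst_refl.
  - destruct Hu as [Hu1 Hu2].
    specialize (IHt1 _ _ _ _ _ Hu1 Hs); specialize (IHt2 _ _ _ _ _ Hu2 Hs).
    rewrite H0 in IHt2; destruct (flex V t1).
    + eapply rst_trans; [apply beta_eta_app; eauto|apply happ_eta_beta].
    + now apply beta_eta_app2.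
  - destruct Hu as [Hu1 Hu2].
    specialize (IHt1 _ _ _ _ _ Hu1 Hs); specialize (IHt2 _ _ _ _ _ Hu2 (Hup _ _ _ _ Hs)).
    rewrite H0 in *; now apply beta_eta_app2, beta_eta_lam.
  - destruct Hu as [Hu1 Hu2].
    specialize (IHt1 _ _ _ _ _ Hu1 Hs); specialize (IHt2 _ _ _ _ _ Hu2 (Hup _ _ _ _ Hs)).
    rewrite H0 in *; now apply beta_eta_app2, beta_eta_lam.
Qed.

Lemma hstep_enc_beta G E t t' :
  all_base E -> beta_root t t' -> hstep (HRS G) E base (enc t) (enc t').
Proof.
  intros HE [A u v].
  (* The variables X, Y and Z of the HRS rule receive the annotation, the body as a function of the
     HRS, and the argument. *)
  set (s := scons (enc A) (scons (HLam (enc u)) (fun _ => enc v))).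
  assert (Hs : forall x, hrs_term E (s x) (hr_env hbeta_rule x)).
  { intros [|[|x]]; simpl; try apply hrs_lam; apply hrs_term_enc; auto.
    now apply all_base_scons. }
  assert (Ht : forall t, hrs_term (hr_env hbeta_rule) t base ->
                         htyping E (hsubst s t) base).
  { intros w Hw; eapply htyping_hsubst; [apply hrs_term_htyping, Hw|].
    intros x; apply hrs_term_htyping, Hs. }
  destruct (HRS_is_hrs nil) with (r := hbeta_rule) as [Hl [Hr _]];
    [intros ? ? []|constructor|].
  apply hstep_root with (r := hbeta_rule) (s := s); auto.
  - constructor.
  - split; [auto|split; [now apply hrs_term_enc|]]; simpl.
    apply beta_eta_app2; [|apply rst_refl].
    apply beta_eta_app2; [apply rst_refl|]; apply beta_eta_lam.
    eapply rst_trans; [apply beta_eta_beta|].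
    unfold hsubst1; rewrite hsubst_hrename, hsubst_id; [apply rst_refl|].
    intros [|x]; auto.
  - split; [auto|split; [now apply hrs_term_enc|]].
    rewrite enc_subst1; apply beta_eta_beta.
Qed.

Lemma hstep_enc_rule G E t t' :
  (forall u v, In (DRule u v) G -> encodable u v) ->
  all_base E -> rule_root G t t' -> hstep (HRS G) E base (enc t) (enc t').
Proof.
  intros HG HE [u v s Hin _].
  destruct (HG _ _ Hin) as [_ [_ [ar [Hu Hv]]]].
  set (hs := fun x => happ_eta (ar x) (enc (s x))).
  assert (Hnf : forall t, uniform ar vempty t ->
    long_nf E base (hsubst hs (encode vempty t)) (enc (subst s t))).
  { intros w Hw; split; [|split; [now apply hrs_term_enc|]].
    - eapply htyping_hsubst.
      + apply hrs_term_htyping.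
        apply hrs_term_encode with (ar := ar) (E := fun x => tpow (ar x)); auto.
        intros x; reflexivity.
      + intros x; apply hrs_term_htyping; now apply hrs_term_happ_eta.
    - pose proof (encode_subst ar vempty 0 w s hs Hw (fun x => eq_refl)) as H.
      destruct (flex vempty w); exact H. }
  apply hstep_root with (r := encode_rule ar u v) (s := hs); simpl; auto.
  - now constructor.
  - intros x; now apply hrs_term_happ_eta.
Qed.

Lemma hstep_enc_ctx R0 R E t t' :
  (forall E t t', all_base E -> R0 t t' -> hstep R E base (enc t) (enc t')) ->
  all_base E -> ctx_closure R0 t t' -> hstep R E base (enc t) (enc t').
Proof.
  intros HR HE H; revert E HE.
  assert (Hc : forall E k a ta b, hconst_type k = arr ta b ->
    htyping E a ta -> htyping E (HApp (HCst k) a) b).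
  { intros E k a ta b Hk Ha; eapply ht_app; eauto. rewrite <- Hk; constructor. }
  assert (He : forall E t, all_base E -> htyping E (enc t) base)
    by (intros; now apply hrs_term_htyping, hrs_term_enc).
  assert (Hl : forall E k a a' ta tb b, hconst_type k = arr ta (arr tb base) ->
    hstep R E ta a a' -> htyping E b tb ->
    hstep R E base (HApp (HApp (HCst k) a) b) (HApp (HApp (HCst k) a') b)).
  { intros E k a a' ta tb b Hk Ha Hb; eapply hstep_app_l; eauto.
    eapply hstep_app_r; eauto. rewrite <- Hk; constructor. }
  induction H; intros E HE; simpl; auto.
  - eapply Hl; eauto; reflexivity.
  - eapply hstep_app_r; eauto; eapply Hc; eauto; reflexivity.
  - eapply Hl; [reflexivity| |constructor]; auto using all_base_scons.
  - eapply hstep_app_r; [eapply Hc; eauto; reflexivity|].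
    constructor; auto using all_base_scons.
  - eapply Hl; [reflexivity| |constructor]; auto using all_base_scons.
  - eapply hstep_app_r; [eapply Hc; eauto; reflexivity|].
    constructor; auto using all_base_scons.
Qed.

Lemma conv_hrewrite G E t u :
  (forall u v, In (DRule u v) G -> encodable u v) -> all_base E -> conv G t u ->
  clos_refl_sym_trans hterm (hrewrite (HRS G) E base) (enc t) (enc u).
Proof.
  intros HG HE; apply clos_rst_map; clear t u; intros t u [_ [_ H]].
  split; [|split]; try now apply hrs_term_enc.
  destruct H as [H|H]; revert HE H; apply hstep_enc_ctx; intros.
  - now apply hstep_enc_beta.
  - now apply hstep_enc_rule.
Qed.

(** * From HRS steps to conversion *)

(** A context accepts a subterm of one syntactic class only, so reductions are read back while
    tracking that class. [TKind], which is never a proper subterm in the grammar, has no stratum. *)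
Inductive stratum : Type := Obj | Typ | Knd.

Definition in_stratum (k : stratum) (t : term) : Prop :=
  match k with Obj => is_object t | Typ => is_type t | Knd => is_kind t end.

Lemma in_stratum_is_term k t : in_stratum k t -> is_term t.
Proof. destruct k; unfold is_term; auto. Qed.

Lemma is_object_not_type t : is_object t -> is_type t -> False.
Proof.
  induction t; intros H1 H2; inversion H1; subst; inversion H2; subst; auto.
Qed.

Lemma in_stratum_unique k k' t : in_stratum k t -> in_stratum k' t -> k = k'.
Proof.
  assert (OK : is_object t -> is_kind t -> False)
    by (intros H1 H2; inversion H2; subst; inversion H1).
  assert (TK : is_type t -> is_kind t -> False).
  { clear; induction t; intros H1 H2; inversion H1; subst; inversion H2; subst; auto. }
  pose proof (is_object_not_type t).
  destruct k, k'; simpl; intros; auto; exfalso; auto.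
Qed.

Lemma is_object_type_rename r t :
  (is_object (rename r t) <-> is_object t) /\ (is_type (rename r t) <-> is_type t).
Proof.
  revert r; induction t; intros r; simpl; split; split; intros H;
    inversion H; subst; constructor;
    try (apply IHt1 with (r := r); assumption);
    try (apply IHt2 with (r := r); assumption);
    try (apply IHt2 with (r := up_ren r); assumption).
Qed.

Lemma is_object_rename r t : is_object (rename r t) <-> is_object t.
Proof. apply is_object_type_rename. Qed.

Lemma is_object_up s : (forall x, is_object (s x)) -> forall x, is_object (up s x).
Proof. intros H [|x]; simpl; [constructor|now apply is_object_rename]. Qed.

Lemma is_object_type_subst s t :
  (forall x, is_object (s x)) ->
  (is_object (subst s t) <-> is_object t) /\ (is_type (subst s t) <-> is_type t).
Proof.
  revert s; induction t; intros s Hs; simpl.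
  (* The variable case: a variable is an object, and so is its image. *)
  3:{ split; split; intros H.
      - constructor.
      - apply Hs.
      - destruct (is_object_not_type (s i)); auto.
      - inversion H. }
  all: try specialize (IHt1 _ Hs).
  (* Of the remaining goals, 5 is the application, while 6 and 7 are the binders, under which the
     substitution is lifted. *)
  5: specialize (IHt2 _ Hs).
  6,7: specialize (IHt2 _ (is_object_up _ Hs)).
  all: split; split; intros H; inversion H; subst; constructor; tauto.
Qed.

Lemma in_stratum_subst k s t :
  (forall x, is_object (s x)) -> k <> Knd -> in_stratum k t -> in_stratum k (subst s t).
Proof.
  intros Hs Hk H; destruct (is_object_type_subst s t Hs).
  destruct k; simpl in *; tauto.
Qed.

Lemma is_object_subst1 u t : is_object u -> is_object (subst1 u t) <-> is_object t.
Proof. intros H; apply is_object_type_subst; intros [|x]; simpl; auto; constructor. Qed.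

Lemma in_stratum_app k t u :
  in_stratum k (App t u) -> k <> Knd /\ in_stratum k t /\ is_object u.
Proof. destruct k; intros H; inversion H; subst; repeat split; auto; discriminate. Qed.

Lemma in_stratum_lam k A t :
  in_stratum k (Lam A t) -> k <> Knd /\ is_type A /\ in_stratum k t.
Proof. destruct k; intros H; inversion H; subst; repeat split; auto; discriminate. Qed.

Lemma in_stratum_pi k A B :
  in_stratum k (Pi A B) -> k <> Obj /\ is_type A /\ in_stratum k B.
Proof. destruct k; intros H; inversion H; subst; repeat split; auto; discriminate. Qed.

Lemma app_in_stratum k t u :
  k <> Knd -> in_stratum k t -> is_object u -> in_stratum k (App t u).
Proof. destruct k; intros H; try easy; constructor; auto. Qed.

Lemma lam_in_stratum k A t :
  k <> Knd -> is_type A -> in_stratum k t -> in_stratum k (Lam A t).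
Proof. destruct k; intros H; try easy; constructor; auto. Qed.

Lemma pi_in_stratum k A B :
  k <> Obj -> is_type A -> in_stratum k B -> in_stratum k (Pi A B).
Proof. destruct k; intros H; try easy; constructor; auto. Qed.

(** Arguments are objects in the grammar, so beta substitutes an object for the variable, which
    keeps the stratum of the body. *)
Lemma beta_in_stratum k t t' : beta t t' -> in_stratum k t -> in_stratum k t'.
Proof.
  intros H; revert k; induction H as [t t' []| | | | | |]; intros k Hk;
    try (apply in_stratum_app in Hk; destruct Hk as [? [? ?]];
         apply app_in_stratum; auto; apply (IHctx_closure Obj); auto; fail);
    try (apply in_stratum_lam in Hk; destruct Hk as [? [? ?]];
         apply lam_in_stratum; auto; apply (IHctx_closure Typ); auto; fail);
    try (apply in_stratum_pi in Hk; destruct Hk as [? [? ?]];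
         apply pi_in_stratum; auto; apply (IHctx_closure Typ); auto; fail).
  apply in_stratum_app in Hk; destruct Hk as [? [Hl ?]].
  apply in_stratum_lam in Hl; destruct Hl as [? [? ?]].
  apply in_stratum_subst; auto. intros [|x]; simpl; auto; constructor.
Qed.

(** Conversion inside one stratum: unlike [conv], it is visibly a congruence. *)
Definition sconv (G : gctx) (k : stratum) : relation term :=
  clos_refl_sym_trans term
    (fun t u => in_stratum k t /\ in_stratum k u /\ (beta t u \/ gamma G t u)).

Lemma sconv_conv G k t u : sconv G k t u -> conv G t u.
Proof.
  apply clos_rst_incl; intros x y [Hx [Hy H]].
  split; [|split]; eauto using in_stratum_is_term.
Qed.

Lemma sconv_map G k k' (f : term -> term) t u :
  (forall t, in_stratum k t -> in_stratum k' (f t)) ->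
  (forall R t u, ctx_closure R t u -> ctx_closure R (f t) (f u)) ->
  sconv G k t u -> sconv G k' (f t) (f u).
Proof.
  intros Hf Hc; apply clos_rst_map; intros x y [Hx [Hy H]].
  split; [|split]; auto. unfold beta, gamma in *; destruct H; auto.
Qed.

Lemma betas_sconv G k t t' :
  clos_refl_trans term beta t t' -> in_stratum k t ->
  in_stratum k t' /\ sconv G k t t'.
Proof.
  induction 1 as [t t' H|t|t t' t'' H1 IH1 H2 IH2]; intros Ht.
  - assert (in_stratum k t') by (eapply beta_in_stratum; eauto).
    split; auto; apply rst_step; auto.
  - split; auto; apply rst_refl.
  - destruct (IH1 Ht) as [Ht' ?], (IH2 Ht').
    split; auto; eapply rst_trans; eauto.
Qed.

(** Conditional on the stratum of the source, because HRS steps also start from encodings of terms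
    outside the grammar. *)
Definition stratified_conv (G : gctx) : relation term :=
  fun t t' => forall k, in_stratum k t -> in_stratum k t' /\ sconv G k t t'.

Lemma stratified_conv_ctx G R t t' :
  inclusion term R (stratified_conv G) -> ctx_closure R t t' ->
  stratified_conv G t t'.
Proof.
  intros HR; induction 1; intros k Hk.
  - now apply HR.
  - apply in_stratum_app in Hk; destruct Hk as [? [? ?]].
    destruct (IHctx_closure k) as [H3 H4]; auto.
    split; [now apply app_in_stratum|].
    revert H4; apply (sconv_map G k k (fun t => App t u)); intros.
    + now apply app_in_stratum.
    + now constructor.
  - apply in_stratum_app in Hk; destruct Hk as [? [? ?]].
    destruct (IHctx_closure Obj) as [H3 H4]; auto.
    split; [now apply app_in_stratum|].
    revert H4; apply sconv_map; intros.
    + now apply app_in_stratum.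
    + now constructor.
  - apply in_stratum_lam in Hk; destruct Hk as [? [? ?]].
    destruct (IHctx_closure Typ) as [H3 H4]; auto.
    split; [now apply lam_in_stratum|].
    revert H4; apply (sconv_map G Typ k (fun A => Lam A t)); intros.
    + now apply lam_in_stratum.
    + now constructor.
  - apply in_stratum_lam in Hk; destruct Hk as [? [? ?]].
    destruct (IHctx_closure k) as [H3 H4]; auto.
    split; [now apply lam_in_stratum|].
    revert H4; apply sconv_map; intros.
    + now apply lam_in_stratum.
    + now constructor.
  - apply in_stratum_pi in Hk; destruct Hk as [? [? ?]].
    destruct (IHctx_closure Typ) as [H3 H4]; auto.
    split; [now apply pi_in_stratum|].
    revert H4; apply (sconv_map G Typ k (fun A => Pi A B)); intros.
    + now apply pi_in_stratum.
    + now constructor.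
  - apply in_stratum_pi in Hk; destruct Hk as [? [? ?]].
    destruct (IHctx_closure k) as [H3 H4]; auto.
    split; [now apply pi_in_stratum|].
    revert H4; apply sconv_map; intros.
    + now apply pi_in_stratum.
    + now constructor.
Qed.

(** * Contracting the instances of encoded rules *)

Definition matching (ar : nat -> nat) (V : vset)
    (s : nat -> term) (hs : nat -> hterm) : Prop :=
  forall x, abs (if V x then 0 else ar x) (s x) (hs x).

Lemma matching_up ar V s hs :
  matching ar V s hs -> matching (scons 0 ar) (scons true V) (up s) (hup hs).
Proof.
  intros H [|x]; simpl.
  - exact (abs_0 (Var 0)).
  - apply abs_rename, H.
Qed.

Lemma betas_app t t' u u' :
  clos_refl_trans term beta t t' -> clos_refl_trans term beta u u' ->
  clos_refl_trans term beta (App t u) (App t' u').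
Proof.
  intros H1 H2; apply rt_trans with (App t' u).
  - revert H1; apply (clos_rt_map _ _ (fun t => App t u)); intros; now constructor.
  - revert H2; apply clos_rt_map; intros; now constructor.
Qed.

Lemma betas_lam t t' u u' :
  clos_refl_trans term beta t t' -> clos_refl_trans term beta u u' ->
  clos_refl_trans term beta (Lam t u) (Lam t' u').
Proof.
  intros H1 H2; apply rt_trans with (Lam t' u).
  - revert H1; apply (clos_rt_map _ _ (fun t => Lam t u)); intros; now constructor.
  - revert H2; apply clos_rt_map; intros; now constructor.
Qed.

Lemma betas_pi t t' u u' :
  clos_refl_trans term beta t t' -> clos_refl_trans term beta u u' ->
  clos_refl_trans term beta (Pi t u) (Pi t' u').
Proof.
  intros H1 H2; apply rt_trans with (Pi t' u).
  - revert H1; apply (clos_rt_map _ _ (fun t => Pi t u)); intros; now constructor.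
  - revert H2; apply clos_rt_map; intros; now constructor.
Qed.

(** Counterpart of [encode_subst] for arbitrary values of the rule variables. Whenever such a
    variable meets an argument, a dummy abstraction is contracted in the calculus and the
    corresponding one in the HRS, so both sides stay related by [abs]. *)
Lemma encode_contract ar V n t s hs :
  uniform_at ar V n t -> matching ar V s hs ->
  exists w z, clos_refl_trans term beta (subst s t) w /\
    beta_eta_equiv (hsubst hs (encode V t)) z /\
    abs (if flex V t then n else 0) w z.
Proof.
  assert (abs0 : forall (b : bool) w z, abs (if b then 0 else 0) w z -> z = enc w)
    by (intros [] w z H; inversion H; auto).
  assert (leaf : forall t, exists w z, clos_refl_trans term beta t w /\
    beta_eta_equiv (enc t) z /\ abs 0 w z).
  { intros u; exists u, (enc u); repeat split; constructor; apply rst_refl. }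
  revert ar V n s hs; induction t; intros ar V n s hs Hu Hs; simpl in *;
    try apply (leaf TKind); try apply (leaf TType);
    try apply (leaf (Cst _)); try apply (leaf (TCst _)).
  - exists (s i), (hs i); split; [apply rt_refl|split; [apply rst_refl|]].
    specialize (Hs i); destruct (V i); simpl; [|rewrite Hu]; auto.
  - destruct Hu as [Hu1 Hu2].
    destruct (IHt1 _ _ _ _ _ Hu1 Hs) as [w1 [z1 [B1 [Q1 P1]]]].
    destruct (IHt2 _ _ _ _ _ Hu2 Hs) as [w2 [z2 [B2 [Q2 P2]]]].
    apply abs0 in P2; subst z2; destruct (flex V t1).
    + inversion P1 as [|n' w z P]; subst.
      exists (subst1 w2 w), (hsubst1 (enc w2) z); repeat split.
      * eapply rt_trans; [apply betas_app; eauto|].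
        apply rt_step, ctx_root; constructor.
      * eapply rst_trans; [apply beta_eta_app; eauto|apply beta_eta_beta].
      * now apply abs_subst1.
    + inversion P1; subst.
      exists (App w1 w2), (enc (App w1 w2)); repeat split.
      * now apply betas_app.
      * now apply beta_eta_app2.
      * constructor.
  - destruct Hu as [Hu1 Hu2].
    destruct (IHt1 _ _ _ _ _ Hu1 Hs) as [w1 [z1 [B1 [Q1 P1]]]].
    destruct (IHt2 _ _ _ _ _ Hu2 (matching_up _ _ _ _ Hs)) as [w2 [z2 [B2 [Q2 P2]]]].
    apply abs0 in P1; apply abs0 in P2; subst.
    exists (Lam w1 w2), (enc (Lam w1 w2)); repeat split.
    + now apply betas_lam.
    + now apply beta_eta_app2, beta_eta_lam.
    + constructor.
  - destruct Hu as [Hu1 Hu2].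
    destruct (IHt1 _ _ _ _ _ Hu1 Hs) as [w1 [z1 [B1 [Q1 P1]]]].
    destruct (IHt2 _ _ _ _ _ Hu2 (matching_up _ _ _ _ Hs)) as [w2 [z2 [B2 [Q2 P2]]]].
    apply abs0 in P1; apply abs0 in P2; subst.
    exists (Pi w1 w2), (enc (Pi w1 w2)); repeat split.
    + now apply betas_pi.
    + now apply beta_eta_app2, beta_eta_lam.
    + constructor.
Qed.

Lemma encode_contract_base ar V t s hs :
  uniform ar V t -> matching ar V s hs ->
  exists w, clos_refl_trans term beta (subst s t) w /\
    beta_eta_equiv (hsubst hs (encode V t)) (enc w).
Proof.
  intros Hu Hs; destruct (encode_contract _ _ _ _ _ _ Hu Hs) as [w [z [B [Q P]]]].
  exists w; split; auto. destruct (flex V t); inversion P; subst; auto.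
Qed.

(** The arguments substituted are objects, and substitution by objects reflects being an object; the
    dummy annotation being a type, the abstracted value is then an object as well. *)
Lemma encode_apps_contract ar V s hs t ys w z :
  matching ar V s hs -> (forall x, V x = true -> is_object (s x)) ->
  flex V t = true -> beta_eta_equiv (hsubst hs (encode V t)) z ->
  abs (length ys) w z -> Forall (fun y => V y = true) ys ->
  exists w', beta_eta_equiv (hsubst hs (encode V (apps t (map Var ys)))) (enc w') /\
    (is_object w' -> is_object w).
Proof.
  intros Hs HV; revert t w z.
  induction ys as [|y ys IH]; intros t w z F Q P Hy; simpl in *.
  - inversion P; subst; eauto.
  - inversion P as [|n w1 z1 P1]; subst.
    inversion Hy as [|? ? Vy Hys]; subst.
    destruct (IH (App t (Var y)) (subst1 (s y) w1) (hsubst1 (enc (s y)) z1))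
      as [w' [Q' O']]; auto.
    + simpl; rewrite F; simpl.
      eapply rst_trans; [|apply beta_eta_beta].
      apply beta_eta_app; auto.
      specialize (Hs y); rewrite Vy in Hs; inversion Hs; apply rst_refl.
    + now apply abs_subst1.
    + exists w'; split; auto. intros H; apply O', is_object_subst1 in H; auto.
      constructor; auto; constructor.
Qed.

Lemma free_apps_vars x t ys :
  free x (apps t (map Var ys)) -> free x t \/ In x ys.
Proof.
  revert t; induction ys as [|y ys IH]; intros t H; simpl in *; auto.
  apply IH in H; simpl in H; tauto.
Qed.

(** In a pattern every free variable heads an argument, and arguments of a term
    of the grammar are objects: so matching binds these variables to objects. *)
Lemma pattern_contract V ar' p :
  lp_pattern V ar' p ->
  forall ar n s hs, uniform_at ar V n p -> matching ar V s hs ->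
  (forall x, V x = true -> is_object (s x)) ->
  exists w, beta_eta_equiv (hsubst hs (encode V p)) (enc w) /\
    (forall k, in_stratum k w -> forall x, free x p -> is_object (s x)) /\
    ((exists x, p = Var x) \/ forall A B, w <> Pi A B).
Proof.
  induction 1 as [V ar' c|V ar' C|V ar' p q Hp IHp Hq IHq|V ar' x Hx
                 |V ar' p x ys Hp IHp Hx Hd Hb Hl|V ar' p A q Hp IHp HA Hq IHq];
    intros ar n s hs Hu Hs HV; simpl in *.
  - exists (Cst c); simpl; repeat split; [apply rst_refl|tauto|right; discriminate].
  - exists (TCst C); simpl; repeat split; [apply rst_refl|tauto|right; discriminate].
  - rewrite (lp_pattern_rigid _ _ _ Hp); destruct Hu as [Hu1 Hu2]; simpl.
    destruct (IHp _ _ _ _ Hu1 Hs HV) as [wp [Qp [Op _]]].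
    destruct (IHq _ _ _ _ Hu2 Hs HV) as [wq [Qq [Oq _]]].
    exists (App wp wq); split; [now apply beta_eta_app2|split; [|right; discriminate]].
    intros k Hk x Hx; apply in_stratum_app in Hk; destruct Hk as [_ [Hk1 Hk2]].
    destruct Hx as [Hx|Hx]; [eapply Op|apply (Oq Obj)]; eauto.
  - exists (s x); specialize (HV x Hx).
    split; [|split; [|left; eauto]].
    + specialize (Hs x); rewrite Hx in Hs; inversion Hs; apply rst_refl.
    + intros k _ y <-; auto.
  - rewrite (lp_pattern_rigid _ _ _ Hp); destruct Hu as [Hu1 Hu2]; simpl.
    destruct (IHp _ _ _ _ Hu1 Hs HV) as [wp [Qp [Op _]]].
    apply uniform_apps in Hu2; auto; rewrite Nat.add_0_r in Hu2.
    pose proof (Hs x) as Hsx; rewrite Hx, <- Hu2 in Hsx.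
    destruct (encode_apps_contract _ _ _ _ (Var x) ys (s x) (hs x) Hs HV) as [wq [Qq Oq]]; eauto.
    { simpl; now rewrite Hx. }
    { apply rst_refl. }
    exists (App wp wq); split; [now apply beta_eta_app2|split; [|right; discriminate]].
    intros k Hk y Hy; apply in_stratum_app in Hk; destruct Hk as [_ [Hk1 Hk2]].
    destruct Hy as [Hy|Hy]; [eapply Op; eauto|].
    apply free_apps_vars in Hy; destruct Hy as [<-|Hy]; auto.
    rewrite Forall_forall in Hb; auto.
  - rewrite (lp_pattern_rigid _ _ _ Hp); destruct Hu as [Hu1 [HuA Hu2]]; simpl.
    destruct (IHp _ _ _ _ Hu1 Hs HV) as [wp [Qp [Op _]]].
    destruct (encode_contract_base _ _ _ _ _ HuA Hs) as [wA [_ QA]].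
    destruct (IHq _ _ _ _ Hu2 (matching_up _ _ _ _ Hs)) as [wq [Qq [Oq _]]].
    { intros [|x] Hx; simpl; [constructor|apply is_object_rename; auto]. }
    exists (App wp (Lam wA wq)); split; [|split; [|right; discriminate]].
    { apply beta_eta_app2; auto; now apply beta_eta_app2, beta_eta_lam. }
    intros k Hk x Hx; apply in_stratum_app in Hk; destruct Hk as [_ [Hk1 Hk2]].
    (* The variables of the annotation all lie in [V], whose images are objects by assumption; those
       of the body come from the induction hypothesis one level up. *)
    destruct Hx as [Hx|[Hx|Hx]]; [eapply Op; eauto|auto|].
    inversion Hk2; subst; specialize (Oq Obj ltac:(assumption) (S x) Hx).
    now apply is_object_rename in Oq.
Qed.

(** * Reading back HRS steps *)

Lemma free_dec x t : {free x t} + {~ free x t}.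
Proof.
  revert x; induction t; intros x; simpl; auto.
  - apply Nat.eq_dec.
  - destruct (IHt1 x), (IHt2 x); tauto.
  - destruct (IHt1 x), (IHt2 (S x)); tauto.
  - destruct (IHt1 x), (IHt2 (S x)); tauto.
Qed.

Lemma subst_ext_free s s' t :
  (forall x, free x t -> s x = s' x) -> subst s t = subst s' t.
Proof.
  revert s s'; induction t; intros s s' H; simpl in *; f_equal; auto.
  all: apply IHt2; intros [|x] Hx; simpl; auto; f_equal; auto.
Qed.

(** The first component is what confines the reduction of a product to its domain and codomain. *)
Definition root_conv (G : gctx) : relation term :=
  fun t t' => (forall A B, t <> Pi A B) /\ stratified_conv G t t'.

Definition hroot (R : hrule -> Prop) (E : tenv) (z z' : hterm) : Prop :=
  exists r s, R r /\ (forall x, hrs_term E (s x) (hr_env r x)) /\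
    long_nf E base (hsubst s (hr_lhs r)) z /\
    long_nf E base (hsubst s (hr_rhs r)) z'.

(** Decoding the HRS substitution gives an instance of the rule in the calculus whose two sides
    beta-reduce to terms encoding the HRS redex and its reduct. Injectivity of [enc] identifies
    these terms, so redex and reduct are linked by beta-expansion, one rule step and
    beta-reduction. *)
Lemma hroot_enc G E t z :
  is_gctx G -> (forall u v, In (DRule u v) G -> encodable u v) ->
  all_base E -> hroot (HRS G) E (enc t) z ->
  exists t', z = enc t' /\ root_conv G t t'.
Proof.
  intros HG Henc HE [r [s [Hr [Hs [[_ [_ Ql]] [_ [Hz Qr]]]]]]].
  rewrite (hrs_term_base_enc E z HE Hz) in *.
  exists (dec z); split; auto; revert Qr; generalize (dec z); clear Hz z; intros t' Qr.
  destruct Hr as [|u v ar Hin Hu Hv]; simpl in *.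
  - pose proof (hrs_term_base_enc E _ HE (Hs 0)) as E0.
    pose proof (hrs_term_base_enc E _ HE (Hs 2)) as E2.
    assert (exists b, s 1 = HLam (enc b)) as [b E1].
    { pose proof (hrs_term_abs E _ 1 HE (Hs 1)) as P.
      inversion P as [|n b z Pb]; inversion Pb; eauto. }
    assert (t = App (Lam (dec (s 0)) b) (dec (s 2))) as ->.
    { apply enc_inj_beta_eta; eapply rst_trans; [apply rst_sym, Ql|simpl].
      rewrite <- E0, <- E2, E1; apply beta_eta_app2; [|apply rst_refl].
      apply beta_eta_app2; [apply rst_refl|]; apply beta_eta_lam.
      eapply rst_trans; [apply beta_eta_beta|].
      unfold hsubst1; rewrite hsubst_hrename, hsubst_id; [apply rst_refl|].
      intros [|x]; auto. }
    assert (t' = subst1 (dec (s 2)) b) as ->.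
    { apply enc_inj_beta_eta; eapply rst_trans; [apply rst_sym, Qr|].
      rewrite enc_subst1, <- E2, E1; apply beta_eta_beta. }
    split; [discriminate|].
    intros k; apply betas_sconv, rt_step, ctx_root; constructor.
  - set (s' := fun x => dec (s x)).
    assert (Hm : matching ar vempty s' s)
      by (intros x; exact (hrs_term_abs E _ _ HE (Hs x))).
    destruct (encode_contract_base _ _ _ _ _ Hu Hm) as [wu [Bu Qu]].
    destruct (encode_contract_base _ _ _ _ _ Hv Hm) as [wv [Bv Qv]].
    destruct (Henc _ _ Hin) as [[ar' Hp] [Hfv _]].
    destruct (pattern_contract _ _ _ Hp _ _ _ _ Hu Hm) as [wp [Qp [Op Np]]];
      [discriminate|].
    assert (t = wu) as <- by
      (apply enc_inj_beta_eta; eapply rst_trans; [apply rst_sym, Ql|exact Qu]).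
    assert (t = wp) as <- by
      (apply enc_inj_beta_eta; eapply rst_trans; [apply rst_sym, Ql|exact Qp]).
    assert (t' = wv) as <- by
      (apply enc_inj_beta_eta; eapply rst_trans; [apply rst_sym, Qr|exact Qv]).
    split.
    (* A pattern without bound variables cannot be a variable, which leaves the case where its
       instance is not a product. *)
    { destruct Np as [[x ->]|Np]; auto.
      inversion Hp; discriminate. }
    intros k Hk; specialize (Op k Hk).
    (* A rule of the calculus is instantiated by objects everywhere, but [s'] is known to give
       objects only on the free variables of [u]. The default [Var 0] elsewhere changes neither
       side, as the variables of [v] occur in [u]. *)
    set (s'' := fun x => if free_dec x u then s' x else Var 0).
    assert (Hs'' : forall x, is_object (s'' x)).
    { intros x; unfold s''; destruct (free_dec x u); [auto|constructor]. }
    assert (Hext : forall w, (forall x, free x w -> free x u) ->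
                             subst s' w = subst s'' w).
    { intros w Hw; apply subst_ext_free; intros x Hx; unfold s''.
      destruct (free_dec x u) as [|N]; auto; destruct N; auto. }
    rewrite Hext in Bu, Bv by auto.
    assert (exists k', k' <> Knd /\ in_stratum k' u /\ in_stratum k' v)
      as [k' [Hk' [Hku Hkv]]].
    { unfold is_gctx in HG; rewrite Forall_forall in HG; specialize (HG _ Hin).
      destruct HG as [HG|HG]; [exists Obj|exists Typ]; split; auto; discriminate. }
    apply (in_stratum_subst k' s'') in Hku; auto.
    apply (in_stratum_subst k' s'') in Hkv; auto.
    destruct (betas_sconv G k' _ _ Bu Hku) as [Ht Cu].
    destruct (betas_sconv G k' _ _ Bv Hkv) as [Ht' Cv].
    (* The redex lies both in [k] and in the stratum of the rule, so these agree. *)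
    rewrite (in_stratum_unique _ _ _ Hk Ht); split; auto.
    eapply rst_trans; [apply rst_sym, Cu|eapply rst_trans; [|exact Cv]].
    apply rst_step; split; [|split]; auto. right; apply ctx_root; now constructor.
Qed.

(** Root steps have base type, so neither the constant nor its partial application, both of function
    type, is a root redex. *)
Lemma hstep_cst_app2_inv R E k a b ta tb z :
  hconst_type k = arr ta (arr tb base) ->
  hstep R E base (HApp (HApp (HCst k) a) b) z ->
  hroot R E (HApp (HApp (HCst k) a) b) z \/
  (exists a', z = HApp (HApp (HCst k) a') b /\ hstep R E ta a a') \/
  (exists b', z = HApp (HApp (HCst k) a) b' /\ hstep R E tb b b').
Proof.
  intros Hk H; inversion H as [E' r s l' r' Hr Hs Hl Hr' | |
      E' c d f f' u Hf Hu|E' c d f u u' Hf Hu]; subst.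
  - left; exists r, s; auto.
  - right; left; inversion Hf as [| |E' c' d' g g' v Hg Hv|E' c' d' g v v' Hg Hv]; subst.
    + inversion Hg.
    + inversion Hg; subst; rewrite Hk in *.
      match goal with H : arr _ _ = arr _ _ |- _ => injection H as -> -> end.
      eauto.
  - right; right; inversion Hf as [| |E' f v c' d' Hg Hv|]; subst.
    inversion Hg; subst; rewrite Hk in *.
    match goal with H : arr _ _ = arr _ _ |- _ => injection H as -> -> end.
    eauto.
Qed.

Lemma hstep_enc_inv G E t z :
  is_gctx G -> (forall u v, In (DRule u v) G -> encodable u v) ->
  all_base E -> hstep (HRS G) E base (enc t) z ->
  exists t', z = enc t' /\ ctx_closure (root_conv G) t t'.
Proof.
  intros HG Henc HE H.
  assert (root : forall E t z, all_base E -> hroot (HRS G) E (enc t) z ->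
    exists t', z = enc t' /\ ctx_closure (root_conv G) t t').
  { clear -HG Henc; intros E t z HE H.
    destruct (hroot_enc G E t z) as [t' []]; eauto using ctx_root. }
  revert E z HE H; induction t; intros E z HE H; simpl in H;
    try (eapply root; eauto;
         inversion H as [E' r s l' r' Hr Hs Hl Hr' | | |]; subst; exists r, s; auto; fail);
    (eapply hstep_cst_app2_inv in H; [|reflexivity];
     destruct H as [H|[[a' [-> H]]|[b' [-> H]]]]; [eapply root; eauto| |]).
  - apply IHt1 in H; auto; destruct H as [t' [-> H]].
    exists (App t' t2); split; [auto|now constructor].
  - apply IHt2 in H; auto; destruct H as [t' [-> H]].
    exists (App t1 t'); split; [auto|now constructor].
  - apply IHt1 in H; auto; destruct H as [t' [-> H]].
    exists (Lam t' t2); split; [auto|now constructor].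
  - inversion H as [|? ? ? ? b Hb| |]; subst.
    apply IHt2 in Hb; auto using all_base_scons; destruct Hb as [t' [-> Hb]].
    exists (Lam t1 t'); split; [auto|now constructor].
  - apply IHt1 in H; auto; destruct H as [t' [-> H]].
    exists (Pi t' t2); split; [auto|now constructor].
  - inversion H as [|? ? ? ? b Hb| |]; subst.
    apply IHt2 in Hb; auto using all_base_scons; destruct Hb as [t' [-> Hb]].
    exists (Pi t1 t'); split; [auto|now constructor].
Qed.

(** * Reducts of products, and product compatibility *)

Lemma hrewrites_pi G E k A B z :
  is_gctx G -> (forall u v, In (DRule u v) G -> encodable u v) ->
  all_base E -> is_type A -> in_stratum k B ->
  clos_refl_trans hterm (hrewrite (HRS G) E base) (enc (Pi A B)) z ->
  exists A' B', z = enc (Pi A' B') /\ conv G A A' /\ conv G B B'.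
Proof.
  intros HG Henc HE HA HB H; apply clos_rt_rt1n in H.
  remember (enc (Pi A B)) as y eqn:Ey; revert A B Ey HA HB.
  induction H as [y|y y' z [_ [_ H]] _ IH]; intros A B -> HA HB.
  - exists A, B; split; [auto|split; apply rst_refl].
  - apply hstep_enc_inv in H; auto; destruct H as [t [-> H]].
    assert (Hroot : inclusion term (root_conv G) (stratified_conv G))
      by (intros u v []; auto).
    inversion H as [u v Hr| | | | |A1 A' B1 HA'|A1 B1 B' HB']; subst.
    (* A root step is excluded, since no redex is a product. *)
    + destruct Hr as [N _]; now destruct (N A B).
    + destruct (stratified_conv_ctx G _ _ _ Hroot HA' Typ HA) as [HA1 CA].
      destruct (IH _ _ eq_refl HA1 HB) as [A2 [B2 [-> [CA2 CB2]]]].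
      exists A2, B2; split; [auto|split; auto].
      eapply rst_trans; [eapply sconv_conv, CA|auto].
    + destruct (stratified_conv_ctx G _ _ _ Hroot HB' k HB) as [HB1 CB].
      destruct (IH _ _ eq_refl HA HB1) as [A2 [B2 [-> [CA2 CB2]]]].
      exists A2, B2; split; [auto|split; auto].
      eapply rst_trans; [eapply sconv_conv, CB|auto].
Qed.

(** Only genuine steps require terms of the grammar; reflexivity relates any term to itself, hence
    the first alternative. *)
Lemma conv_is_term G t u : conv G t u -> t = u \/ is_term t /\ is_term u.
Proof.
  induction 1 as [t u [? [? _]]| |t u _ IH|t u v _ IH1 _ IH2]; auto.
  - destruct IH as [|[]]; auto.
  - destruct IH1 as [->|[]], IH2 as [<-|[]]; auto.
Qed.

Lemma is_term_pi A B : is_term (Pi A B) -> is_type A /\ exists k, in_stratum k B.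
Proof.
  intros [H|[H|[H|H]]]; inversion H; subst; split; auto.
  - now exists Typ.
  - now exists Knd.
Qed.

Theorem mainTheorem10 (G : gctx) :
  is_gctx G ->
  (forall u v, In (DRule u v) G -> encodable u v) ->
  hrs_confluent (HRS G) ->
  product_compatibility G.
Proof.
  intros HG Henc Hconf D A1 B1 A2 B2 _ _ _ HC.
  destruct (conv_is_term _ _ _ HC) as [[= -> ->]|[H1 H2]];
    [split; apply rst_refl|].
  apply is_term_pi in H1; destruct H1 as [HA1 [k1 HB1]].
  apply is_term_pi in H2; destruct H2 as [HA2 [k2 HB2]].
  set (E := fun _ : nat => base).
  assert (HE : all_base E) by (intros x; reflexivity).
  apply (conv_hrewrite G E) in HC; auto.
  apply confluent_joinable in HC; [|apply Hconf]; destruct HC as [z [R1 R2]].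
  apply hrewrites_pi with (k := k1) in R1; auto.
  apply hrewrites_pi with (k := k2) in R2; auto.
  destruct R1 as [A [B [-> [CA1 CB1]]]], R2 as [A' [B' [Eq [CA2 CB2]]]].
  (* The common reduct encodes a product reached from either side; injectivity makes the two
     products equal, and their components link the given ones. *)
  assert (Pi A B = Pi A' B') as [= -> ->]
    by (apply enc_inj_beta_eta; rewrite Eq; apply rst_refl).
  split; eapply rst_trans; eauto; now apply rst_sym.
Qed.
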